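(* There exists an absolute constant $C_2\geq 1$ such that for every $n\geq 1$, every log-concave random vector $X=(X_1,\ldots,X_n)$ with values in $\mathbb{R}^n$, and every $r\in[1,\infty)$, $$ \left(\mathbb{E}\|X\|_r^p\right)^{1/p}\leq C_2\, r\left(\mathbb{E}\|X\|_r+\sigma_{r,X}(p)\right)\quad\text{for all } p\geq 1 . $$
   Context: A random vector $X$ in $\mathbb{R}^n$ is log-concave if its distribution $\mu$ satisfies $\mu(\lambda K+(1-\lambda)L)\geq \mu(K)^{\lambda}\mu(L)^{1-\lambda}$ for all compact nonempty sets $K,L\subset\mathbb{R}^n$ and all $\lambda\in[0,1]$. For $x\in\mathbb{R}^n$ and $r\in[1,\infty)$, $\|x\|_r=(\sum_{i=1}^n|x_i|^r)^{1/r}$, and $\|x\|_\infty=\max_i|x_i|$. For $p\geq 1$, $$ \sigma_{r,X}(p):=\sup_{\|t\|_{r'}\leq 1}\left(\mathbb{E}\left|\sum_{i=1}^n t_iX_i\right|^p\right)^{1/p}, $$ where the supremum is over $t\in\mathbb{R}^n$ and $r'$ is the Hölder dual of $r$: $r'=\frac{r}{r-1}$ for $r>1$ and $r'=\infty$ for $r=1$. ''Absolute constant'' means a constant that does not depend on $n$, $r$, $X$, $p$ or anything else. *)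

(* Defs.v *)
From HB Require Import structures.
From mathcomp Require Import all_boot all_order all_algebra.
From mathcomp Require Import all_classical all_reals all_analysis.

Set Implicit Arguments.
Unset Strict Implicit.
Unset Printing Implicit Defensive.

Import Order.TTheory GRing.Theory Num.Theory.
Import numFieldNormedType.Exports.

Local Open Scope classical_set_scope.
Local Open Scope ring_scope.

(* The intended range of [s] is [1, +oo]; the [-oo] branch is a dummy value. *)
Definition lnorm (R : realType) (n : nat) (s : \bar R) (x : 'rV[R]_n) : R :=
  match s with
  | r%:E => (\sum_(i < n) `|x ord0 i| `^ r) `^ r^-1
  | +oo%E => \big[Num.max/0]_(i < n) `|x ord0 i|
  | -oo%E => 0
  end.

(* The set [l K + (1 - l) L]. *)
Definition minkowski_conv (R : realType) (n : nat) (l : R)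
    (K L : set 'rV[R]_n) : set 'rV[R]_n :=
  [set l *: x + (1 - l) *: y | x in K & y in L].

(* A random vector of R^n is given by its coordinates, which are random
   variables on a common probability space: measurability with respect to the
   Borel sets of R^n is coordinatewise measurability. *)
Definition random_row d (T : measurableType d) (R : realType)
    (P : probability T R) (n : nat) (X : 'I_n -> {RV P >-> R}) (w : T)
    : 'rV[R]_n :=
  \row_(i < n) X i w.

(* The distribution of [X]; meaningful on Borel sets only, in particular on
   the compact sets on which [log_concave] evaluates it. *)
Definition law d (T : measurableType d) (R : realType) (P : probability T R)
    (n : nat) (X : 'I_n -> {RV P >-> R}) (A : set 'rV[R]_n) : \bar R :=
  P (random_row X @^-1` A).

Definition log_concave d (T : measurableType d) (R : realType)
    (P : probability T R) (n : nat) (X : 'I_n -> {RV P >-> R}) : Prop :=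
  forall K L : set 'rV[R]_n,
    compact K -> K !=set0 -> compact L -> L !=set0 ->
  forall l : R, 0 <= l <= 1 ->
    (law X K `^ l * law X L `^ (1 - l) <= law X (minkowski_conv l K L))%E.

(* [hoelder_conjugate 1 = +oo]. The supremum is taken in the extended reals,
   as the moments are not known a priori to be finite. *)
Definition weak_moment d (T : measurableType d) (R : realType)
    (P : probability T R) (n : nat) (X : 'I_n -> {RV P >-> R}) (r p : R)
    : \bar R :=
  ereal_sup
    [set ('E_P[(fun w => `|\sum_(i < n) t ord0 i * X i w| `^ p)%R] `^ p^-1)%E
    | t in [set t : 'rV[R]_n | lnorm (hoelder_conjugate r%:E) t <= 1]].

(* Main.v *)
Require Import Defs.
From HB Require Import structures.
From mathcomp Require Import all_boot all_order all_algebra.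
From mathcomp Require Import all_classical all_reals all_analysis.
From mathcomp Require Import measurable_realfun.
From mathcomp Require Import ring lra.

Set Implicit Arguments.
Unset Strict Implicit.
Unset Printing Implicit Defensive.

Import Order.TTheory GRing.Theory Num.Theory.
Import numFieldNormedType.Exports.

Local Open Scope classical_set_scope.
Local Open Scope ring_scope.

(* Take scales d_i slightly above E|X_i|, so that |d|_r is at most of order
   E|X|_r, and cut the i-th axis into slabs of width d_i. Grow a tree of events,
   each an intersection A of slabs. If along some coordinate every slab carries
   only a small fraction of P(A), branch over the slabs of that coordinate.
   Otherwise log-concavity makes every X_i / d_i, conditionally on A,
   exponentially concentrated around some m_i: points with
   |X - (m_i d_i)|_r <= C r |d|_r stop at A, and the others branch over all
   coordinates i, with weights (d_i / |d|_r)^r times an exponential gain. At a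
   stopped node, pairing with a norming vector of (m_i d_i) and Borell's tail
   bound give |(m_i d_i)|_r <= C (sigma P(A)^(-1/4p) + |d|_r).
   Hence E|X|_r^p is at most (C r (sigma + |d|_r))^p times the sum over the nodes
   of weight * P(A)^(3/4). The factor P(A)^(1/4) gains a small constant per
   generation, while the sum of weight * P(A)^(1/2) over generation k is at most
   C^k: for boxes B in the same coordinates as A and close to the origin,
   (P(A) P(B))^(1/2) <= P((A + B) / 2), and the midpoint sets hardly overlap. *)

(** Where the exponents come from: the loss P(A)^(-1/4p) in Borell's bound becomes P(A)^(-1/4) in
    the p-th moment, so a node that stops costs P(A)^(3/4), which splits into a part 1/4 that pays
    for the weights and a part 1/2 that pays for the number of nodes. The constants depend on each
    other in this order: the entropy constant C is absolute; theta = 1/(2C) makes generation k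
    contribute a multiple of 2^(-k); the slab threshold theta^4 P(A) fixes the rate of
    concentration; the rate fixes the stopping radius. The radius is of order r |d|_r so that an
    exponential beats y^r uniformly in r, and this is the only source of the factor r in the
    theorem. The obstacle is that the tree is adaptive and that neither the dimension nor the number
    of slabs may enter the bounds, so nodes cannot simply be counted. The tree is built over a
    bounded region to keep it finitely branching, and the bound survives the exhaustion of the space
    by such regions. *)

Section sublevel_sets.
Context d (T : measurableType d) (R : realType) (f : T -> R) (mf : measurable_fun setT f).

Lemma measurable_superlevel (a : R) : measurable [set w | a <= f w].
Proof.
rewrite -[X in measurable X]setTI.
have -> : [set w | a <= f w] = f @^-1` `[a, +oo[%classic.
  by apply/seteqP; split => w /=; rewrite in_itv/= andbT.
exact: mf.
Qed.

Lemma measurable_strict_sublevel (a : R) : measurable [set w | f w < a].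
Proof.
rewrite -[X in measurable X]setTI.
have -> : [set w | f w < a] = f @^-1` `]-oo, a[%classic.
  by apply/seteqP; split => w /=; rewrite in_itv.
exact: mf.
Qed.

End sublevel_sets.

(** * Real-valued probabilities and integrals of weighted step functions *)

Section finite_probability.
Context d (T : measurableType d) (R : realType) (P : probability T R).

Definition Pr (A : set T) : R := fine (P A).

Lemma EFin_Pr A : measurable A -> P A = (Pr A)%:E.
Proof. by move=> mA; rewrite /Pr fineK// fin_num_measure. Qed.

Lemma Pr_ge0 A : 0 <= Pr A.
Proof. exact: fine_ge0. Qed.

Lemma Pr_le1 A : measurable A -> Pr A <= 1.
Proof. by move=> mA; rewrite -lee_fin -EFin_Pr// probability_le1. Qed.

Lemma le_Pr A B : measurable A -> measurable B -> A `<=` B -> Pr A <= Pr B.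
Proof.
by move=> mA mB AB; rewrite -lee_fin -!EFin_Pr//; apply: le_measure; rewrite ?inE.
Qed.

Lemma PrT : Pr setT = 1.
Proof. by rewrite /Pr probability_setT. Qed.

Lemma Pr0 : Pr set0 = 0.
Proof. by rewrite /Pr measure0. Qed.

Lemma Pr_setC A : measurable A -> Pr (~` A) = 1 - Pr A.
Proof.
move=> mA; apply: EFin_inj; rewrite -EFin_Pr ?probability_setC ?EFinB ?EFin_Pr//.
exact: measurableC.
Qed.

Section step_functions.
Context (I : Type) (s : seq I) (c : I -> R) (E : I -> set T).
Context (c0 : forall i, 0 <= c i).
Context (mE : forall i, measurable (E i)).

Lemma measurable_step : measurable_fun setT (fun w => \sum_(i <- s) c i * \1_(E i) w).
Proof. by apply: measurable_sum => i; apply: measurable_funM. Qed.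

Lemma integral_step :
  (\int[P]_w (\sum_(i <- s) c i * \1_(E i) w)%:E)%E
  = (\sum_(i <- s) c i * Pr (E i))%:E.
Proof.
under eq_integral do rewrite -sumEFin.
rewrite ge0_integral_sum//; first last.
- by move=> i w _; rewrite lee_fin mulr_ge0.
- by move=> i; apply/measurable_EFinP; apply: measurable_funM.
rewrite -sumEFin; apply: eq_bigr => i _.
under eq_integral do rewrite EFinM.
rewrite ge0_integralZl_EFin//; last first.
  by apply/measurable_EFinP.
by rewrite integral_indic// setIT EFinM -EFin_Pr.
Qed.

Lemma integral_le_step (D : set T) (f : T -> R) : measurable D ->
  measurable_fun setT f -> (forall w, 0 <= f w) ->
  (forall w, D w -> f w <= \sum_(i <- s) c i * \1_(E i) w) ->
  (\int[P]_(w in D) (f w)%:E <= (\sum_(i <- s) c i * Pr (E i))%:E)%E.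
Proof.
move=> mD mf f0 fle; rewrite -integral_step.
have s0 w : (0 <= (\sum_(i <- s) c i * \1_(E i) w)%:E :> \bar R)%E.
  by rewrite lee_fin sumr_ge0// => i _; rewrite mulr_ge0.
apply: (@le_trans _ _ (\int[P]_(w in D) (\sum_(i <- s) c i * \1_(E i) w)%:E)%E).
  apply: ge0_le_integral => //.
  - by move=> w _; rewrite lee_fin.
  - by apply/measurable_EFinP; exact: measurable_funTS.
  - by apply/measurable_EFinP; apply: measurable_funTS; exact: measurable_step.
apply: ge0_subset_integral => //.
by apply/measurable_EFinP; exact: measurable_step.
Qed.
End step_functions.

(** Weighted sums of probabilities of overlapping events are compared by integrating a pointwise
    inequality between counting functions. *)
Lemma le_Pr_step (I J : Type) (s : seq I) (t : seq J) (c : I -> R) (b : J -> R)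
    (E : I -> set T) (F : J -> set T) :
  (forall i, 0 <= c i) -> (forall i, measurable (E i)) ->
  (forall j, 0 <= b j) -> (forall j, measurable (F j)) ->
  (forall w, \sum_(i <- s) c i * \1_(E i) w <= \sum_(j <- t) b j * \1_(F j) w) ->
  \sum_(i <- s) c i * Pr (E i) <= \sum_(j <- t) b j * Pr (F j).
Proof.
move=> c0 mE b0 mF le; rewrite -lee_fin -(integral_step s c0 mE).
apply: integral_le_step => //; first exact: measurable_step.
by move=> w; rewrite sumr_ge0// => i _; rewrite mulr_ge0.
Qed.

(** Monotone convergence along the truncations of [f] to [B N]. On each [B N] a step function with
    finitely many pieces can dominate [f], and the bound [c] does not see [N]. *)
Lemma integral_le_exhaustion (A : set T) (B : nat -> set T) (f : T -> R) (c : \bar R) :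
  measurable A -> (forall N, measurable (B N)) ->
  (forall M N, (M <= N)%N -> B M `<=` B N) -> (forall w, exists N, B N w) ->
  measurable_fun setT f -> (forall w, 0 <= f w) ->
  (forall N, \int[P]_(w in A `&` B N) (f w)%:E <= c)%E ->
  (\int[P]_(w in A) (f w)%:E <= c)%E.
Proof.
move=> mA mB ndB exB mf f0 le.
pose g N w := (f w * \1_(B N) w)%:E.
have mg N : measurable_fun A (g N).
  by apply/measurable_EFinP; apply: measurable_funTS; apply: measurable_funM.
have g0 N w : A w -> (0 <= g N w)%E by move=> _; rewrite lee_fin mulr_ge0.
have ndg w : A w -> {homo g ^~ w : n m / (n <= m)%N >-> (n <= m)%E}.
  move=> _ m n mn; rewrite lee_fin ler_wpM2l//.
  by rewrite !indicE ler_nat; case: (boolP (w \in B m)) => //;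
     rewrite inE => /(ndB _ _ mn) Bn; rewrite mem_set.
have glim w : A w -> limn (g ^~ w) = (f w)%:E.
  move=> _; apply/cvg_lim => //; have [N BN] := exB w.
  apply: cvg_near_cst; near=> n.
  rewrite /g indicE mem_set ?mulr1//; apply: (ndB N) => //.
  by near: n; exact: nbhs_infty_ge.
have -> : (\int[P]_(w in A) (f w)%:E = \int[P]_(w in A) limn (g ^~ w))%E.
  by apply: eq_integral => w; rewrite inE => Aw; rewrite glim.
rewrite monotone_convergence//; apply: lime_le.
  exact/cvgP/(cvg_monotone_convergence mA mg g0 ndg).
near=> N; apply: le_trans (le N).
rewrite integral_mkcondr le_eqVlt; apply/orP; left; apply/eqP.
apply: eq_integral => w _.
by rewrite /g patchE indicE; case: ifP; rewrite ?mulr1 ?mulr0.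
Unshelve. all: by end_near. Qed.

End finite_probability.

(** * Log-concavity for closed sets *)

Section log_concave_law.
Context d (T : measurableType d) (R : realType) (P : probability T R) (n : nat).
Context (X : 'I_n -> {RV P >-> R}).
Local Notation Pr := (Pr P).

(** Balls of ['rV[R]_n] are cubes, so their preimages are finite intersections of coordinate events;
    an open set is the countable union of the rational balls that it contains. *)
Lemma measurable_random_row_open (U : set 'rV[R]_n) :
  open U -> measurable (random_row X @^-1` U).
Proof.
move=> oU.
pose B (qk : 'rV[rat]_n * nat) : set 'rV[R]_n :=
  ball (map_mx (@ratr R) qk.1) (qk.2.+1%:R^-1).
pose F qk := if pselect (B qk `<=` U) then random_row X @^-1` B qk else set0.
have mB qk : measurable (random_row X @^-1` B qk).
  have -> : random_row X @^-1` B qk =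
      \bigcap_(i in [set: 'I_n]) (X i @^-1` ball (ratr (qk.1 ord0 i) : R) (qk.2.+1%:R^-1)).
    apply/seteqP; split => w /=.
      by move=> [_ h] i _ /=; have := h ord0 i; rewrite !mxE.
    by move=> h; split=> [|i j]; [rewrite invr_gt0|have := h j I; rewrite (ord1 i) !mxE].
  apply: fin_bigcap_measurable => // i _.
  rewrite -[X in measurable X]setTI.
  by apply: (measurable_funP (X i)) => //; apply: open_measurable; exact: ball_open.
suff -> : random_row X @^-1` U = \bigcup_qk F qk.
  apply: countable_bigcupT_measurable => [|qk].
    exact: countableP.
  by rewrite /F; case: pselect => ?; [exact: mB|exact: measurable0].
apply/seteqP; split => w /=; last first.
  by case=> qk _; rewrite /F; case: pselect => // BU /BU.
move=> Uw; have /nbhs_ballP[e /= e0 eU] := open_nbhs_nbhs (conj oU Uw).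
have [k ke] : exists k : nat, k.+1%:R^-1 < e / 2.
  have e20 : 0 < e / 2 by rewrite divr_gt0.
  exists (Num.truncn (e / 2)^-1).
  by rewrite invf_plt ?posrE// truncnS_gt.
have rq (i : 'I_n) : exists q : rat, `|ratr q - X i w| < k.+1%:R^-1 :> R.
  have kp : 0 < k.+1%:R^-1 :> R by rewrite invr_gt0.
  have [|q] := @rat_in_itvoo R (X i w - k.+1%:R^-1) (X i w + k.+1%:R^-1).
    by rewrite ltrD2l gtrN.
  rewrite in_itv/= => /andP[a b]; exists q; rewrite ltr_norml.
  by rewrite ltrBrDr ltrBlDr addrC a addrC b.
have [q hq] := choice rq.
have wB : B (\row_i q i, k) (random_row X w).
  by split => [|i j]; [rewrite invr_gt0|rewrite /ball /= !mxE].
exists (\row_i q i, k) => //; rewrite /F; case: pselect => // -[] y By; apply: eU.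
rewrite [e]splitr; apply: (@ball_triangle _ _ (map_mx (@ratr R) (\row_i q i))).
  by apply: ball_sym; apply: le_ball wB; exact: ltW.
by apply: le_ball By; exact: ltW.
Qed.

Lemma measurable_random_row_closed (K : set 'rV[R]_n) :
  closed K -> measurable (random_row X @^-1` K).
Proof.
move=> cK; rewrite -[K]setCK -preimage_setC; apply: measurableC.
by apply: measurable_random_row_open; exact: closed_openC.
Qed.

Lemma compact_minkowski_conv (l : R) (K L : set 'rV[R]_n) :
  compact K -> compact L -> compact (minkowski_conv l K L).
Proof.
move=> cK cL.
have -> : minkowski_conv l K L =
    (fun z : 'rV[R]_n * 'rV[R]_n => l *: z.1 + (1 - l) *: z.2) @` (K `*` L).
  apply/seteqP; split => z /=.
    by move=> [x Kx [y Ly <-]]; exists (x, y).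
  by move=> [[x y] /= [Kx Ly] <-]; exists x => //; exists y.
apply: continuous_compact; last exact: compact_setX.
apply: continuous_subspaceT => z.
by apply: cvgD; apply: cvgZr; [exact: cvg_fst|exact: cvg_snd].
Qed.

Let compact_closed_rV (A : set 'rV[R]_n) : compact A -> closed A.
Proof. by apply: compact_closed; exact: norm_hausdorff. Qed.

Let cube (M : nat) : set 'rV[R]_n :=
  [set x : 'rV[R]_n | forall i, `[- M%:R, M%:R]%classic (x ord0 i)].

Let compact_cube M : compact (cube M).
Proof.
have := @rV_compact R n (fun=> `[- M%:R, M%:R]%classic) (fun=> @segment_compact _ _ _).
exact.
Qed.

Let Pr_cube (K : set 'rV[R]_n) : closed K ->
  Pr (random_row X @^-1` (K `&` cube M)) @[M --> \oo] --> Pr (random_row X @^-1` K).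
Proof.
move=> cK.
have mK := measurable_random_row_closed cK.
have mKM M : measurable (random_row X @^-1` (K `&` cube M)).
  apply: measurable_random_row_closed; apply: closedI => //.
  exact: (compact_closed_rV (@compact_cube M)).
apply: fine_cvg; rewrite -EFin_Pr//.
have UK : \bigcup_M (random_row X @^-1` (K `&` cube M)) = random_row X @^-1` K.
  apply/seteqP; split => w /=; first by move=> [M _ []].
  move=> Kw; exists (Num.truncn (\sum_i `|X i w|)).+1 => //; split => // i.
  rewrite /= in_itv/= -ler_norml mxE.
  apply: le_trans (ltW (truncnS_gt _)).
  by rewrite (bigD1 i)//= lerDl sumr_ge0.
rewrite -UK; apply: nondecreasing_cvg_mu => //; first by rewrite UK.
move=> M N MN; apply/subsetPset => w [Kw cw]; split => // i.
have := cw i; rewrite /= !in_itv/= => /andP[a b].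
have MN' : M%:R <= N%:R :> R by rewrite ler_nat.
by apply/andP; split; lra.
Qed.

(** The definition covers nonempty compact sets only: cut [K] and [L] by growing cubes and pass to
    the limit. For [l] strictly between 0 and 1 an empty trace is harmless, as 0 to the power [l] is
    0. *)
Lemma log_concave_closed (K L C : set 'rV[R]_n) (l : R) :
  log_concave X -> 0 < l < 1 -> closed K -> closed L ->
  measurable (random_row X @^-1` C) ->
  (forall x y, K x -> L y -> C (l *: x + (1 - l) *: y)) ->
  Pr (random_row X @^-1` K) `^ l * Pr (random_row X @^-1` L) `^ (1 - l)
    <= Pr (random_row X @^-1` C).
Proof.
move=> hX /andP[l0 l1] cK cL mC KLC.
have l1' : 0 < 1 - l by rewrite subr_gt0.
pose a M := Pr (random_row X @^-1` (K `&` cube M)).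
pose b M := Pr (random_row X @^-1` (L `&` cube M)).
have H M : a M `^ l * b M `^ (1 - l) <= Pr (random_row X @^-1` C).
  have [KM0|/set0P KM] := eqVneq (K `&` cube M) set0.
    rewrite /a KM0 preimage_set0 Pr0 powR0 ?mul0r ?Pr_ge0//; exact: lt0r_neq0.
  have [LM0|/set0P LM] := eqVneq (L `&` cube M) set0.
    rewrite /b LM0 preimage_set0 Pr0 [X in _ * X]powR0 ?mulr0 ?Pr_ge0//.
    exact: lt0r_neq0.
  have cKM : compact (K `&` cube M).
    by rewrite setIC; apply: compact_closedI => //; exact: compact_cube.
  have cLM : compact (L `&` cube M).
    by rewrite setIC; apply: compact_closedI => //; exact: compact_cube.
  have mcl (A : set 'rV[R]_n) : compact A -> measurable (random_row X @^-1` A).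
    by move=> cA; apply: measurable_random_row_closed; exact: compact_closed_rV.
  have l01 : 0 <= l <= 1 by rewrite !ltW.
  have := hX _ _ cKM KM cLM LM l l01.
  rewrite /law !EFin_Pr ?poweR_EFin; try exact: mcl.
    rewrite -EFinM lee_fin => /le_trans; apply; apply: le_Pr => //.
      by apply: mcl; exact: compact_minkowski_conv.
    by move=> w /= [x [Kx _] [y [Ly _] <-]]; exact: KLC.
  by apply: mcl; exact: compact_minkowski_conv.
have [A0|A0] := eqVneq (Pr (random_row X @^-1` K)) 0.
  by rewrite A0 powR0 ?mul0r ?Pr_ge0// lt0r_neq0.
have [B0|B0] := eqVneq (Pr (random_row X @^-1` L)) 0.
  by rewrite B0 [X in _ * X]powR0 ?mulr0 ?Pr_ge0// lt0r_neq0.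
set A := Pr _ in A0 *; set B := Pr _ in B0 *; set c := Pr _ in H *.
have Ap : 0 < A by rewrite lt0r A0 Pr_ge0.
have Bp : 0 < B by rewrite lt0r B0 Pr_ge0.
(* Losing a factor [e] replaces the continuity of powers: on a large cube the two probabilities
   exceed [e * A] and [e * B], and [e] is the product of its powers [l] and [1 - l]. *)
have He (e : R) : 0 < e < 1 -> e * (A `^ l * B `^ (1 - l)) <= c.
  move=> /andP[e0 e1].
  have /cvgr_gt hA := Pr_cube cK.
  have /cvgr_gt hB := Pr_cube cL.
  have eA : e * A < A by rewrite gtr_pMl.
  have eB : e * B < B by rewrite gtr_pMl.
  near \oo => M.
  apply: le_trans (H M).
  have ee : e = e `^ l * e `^ (1 - l).
    by rewrite -powRD ?(gt_eqF e0) ?implybT// addrC subrK powRr1// ltW.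
  rewrite {1}ee mulrACA -!powRM ?(ltW e0, ltW Ap, ltW Bp)//.
  have eA0 : 0 <= e * A by rewrite mulr_ge0// ltW.
  have eB0 : 0 <= e * B by rewrite mulr_ge0// ltW.
  apply: ler_pM; rewrite ?powR_ge0//; apply: ge0_ler_powR;
    rewrite ?nnegrE ?Pr_ge0 ?(ltW l0) ?(ltW l1')//; apply: ltW.
    by near: M; exact: hA.
  by near: M; exact: hB.
rewrite leNgt; apply/negP => cAB.
have ABp : 0 < A `^ l * B `^ (1 - l) by rewrite mulr_gt0 ?powR_gt0.
have c0 : 0 <= c by exact: Pr_ge0.
set z := _ * _ in He cAB ABp.
(* If [c < z], the midpoint of [c / z] and 1 is an admissible [e] that contradicts [He]. *)
have := He ((c / z + 1) / 2).
have cz : c / z < 1 by rewrite ltr_pdivrMr ?mul1r.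
have cz0 : 0 <= c / z by rewrite divr_ge0// ltW.
have -> : (c / z + 1) / 2 * z = (c + z) / 2 by field; exact: lt0r_neq0.
by lra.
Unshelve. all: by end_near. Qed.

End log_concave_law.

(** * Tails of log-concave functions, series and windows *)

Section real_estimates.
Context (R : realType).
Implicit Types (x y r : R) (v : R -> R).

Lemma ler_powR_base (a x y : R) : 0 <= a -> 0 <= x -> x <= y -> x `^ a <= y `^ a.
Proof.
by move=> a0 x0 xy; apply: ge0_ler_powR; rewrite ?nnegrE// (le_trans x0).
Qed.

Lemma half_powR_le_expR y : 0 <= y -> (2^-1) `^ y <= expR (- (y / 2)).
Proof.
move=> y0; rewrite (_ : - (y / 2) = (- 2^-1) * y) 1?expRM; last by field.
apply: ge0_ler_powR => //; rewrite ?nnegrE ?invr_ge0 ?expR_ge0//.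
by have := expR_ge1Dx (- 2^-1 : R); lra.
Qed.

(* The hypothesis on arithmetic progressions makes the values of [v] at points
   more than 2 apart nearly disjoint, so if [v] did not halve within a bounded
   distance of [c0], log-concavity would make too many of them large. *)
Lemma slab_tail (eps : R) : 0 < eps -> exists2 k : R, 0 < k &
  forall v (a c0 : R), 0 < a -> (forall c, 0 <= v c <= a) ->
  (forall l c c' : R, 0 < l < 1 ->
     v c `^ l * v c' `^ (1 - l) <= v (l * c + (1 - l) * c')) ->
  (forall N (delta : R), 2 <= `|delta| -> \sum_(j < N) v (c0 + j%:R * delta) <= a) ->
  eps * a <= v c0 ->
  forall c, v c <= 2 * a * expR (- (k * `|c - c0|)).
Proof.
move=> eps0.
(* [N] values of at least [eps * a / 2] sum to more than [a], and beyond the distance [D0] the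
   segment from [c0] to [c] has room for [N] points with gaps of at least 2. *)
pose N := (Num.truncn (2 / eps)).+1.
have N0 : 0 < N%:R :> R by rewrite ltr0n.
have Neps : 2 < eps * N%:R.
  by rewrite -ltr_pdivrMl// mulrC; exact: truncnS_gt.
pose D0 : R := 2 * N%:R.
have D00 : 0 < D0 by rewrite mulr_gt0.
exists (D0^-1 / 2) => [|v a c0 a0 va lc disj vc0]; first by rewrite divr_gt0 ?invr_gt0.
have v0 c : 0 <= v c by case/andP: (va c).
have vc0p : 0 < v c0 by apply: lt_le_trans vc0; rewrite mulr_gt0.
have half c : D0 <= `|c - c0| -> v c <= v c0 / 2.
  move=> Dc; rewrite leNgt; apply/negP => lt.
  pose delta := (c - c0) / N%:R.
  have d2 : 2 <= `|delta|.
    by rewrite normf_div (gtr0_norm N0) ler_pdivlMr.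
  have := disj N delta d2.
  suff : a < \sum_(j < N) v (c0 + j%:R * delta) by lra.
  apply: (@lt_le_trans _ _ (\sum_(j < N) v c0 / 2)).
    rewrite sumr_const card_ord -[X in _ < X]mulr_natr.
    apply: (@lt_le_trans _ _ (eps * a / 2 * N%:R)).
      rewrite (_ : _ * N%:R = a * (eps * N%:R / 2)); last by ring.
      by rewrite ltr_pMr// ltr_pdivlMr// mul1r.
    by rewrite ler_wpM2r ?ler0n//; lra.
  apply: ler_sum => j _.
  have [j0|j0] := eqVneq (j : nat) 0%N.
    by rewrite j0 mul0r addr0; lra.
  have jl : 0 < (j%:R / N%:R : R) < 1.
    rewrite divr_gt0 ?ltr0n ?lt0n//= ltr_pdivrMr// mul1r ltr_nat.
    exact: ltn_ord.
  have := lc _ c c0 jl.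
  rewrite (_ : _ * c + _ = c0 + j%:R * delta); last first.
    by rewrite /delta; field; exact: lt0r_neq0.
  apply: le_trans; move: jl; set l := _ / _ => /andP[l0 l1].
  have vh : 0 < v c0 / 2 by rewrite divr_gt0.
  have -> : v c0 / 2 = (v c0 / 2) `^ l * (v c0 / 2) `^ (1 - l).
    by rewrite -powRD ?(gt_eqF vh) ?implybT// addrC subrK powRr1// ltW.
  apply: ler_pM; rewrite ?powR_ge0//; apply: ge0_ler_powR;
    rewrite ?nnegrE ?subr_ge0 ?(ltW l0, ltW l1, ltW vh, ltW lt)//.
  by rewrite ler_pdivrMr// ler_peMr ?ler1n.
(* Within [D0] the bound is trivial, since [2 * expR (- 2^-1)] is at least 1. *)
move=> c; have [hD|hD] := leP `|c - c0| D0.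
  have : expR (- 2^-1) <= expR (- (D0^-1 / 2 * `|c - c0|)).
    rewrite ler_expR lerN2 mulrAC ler_piMl ?invr_ge0//.
    by rewrite ler_pdivrMl// mulr1.
  have := expR_ge1Dx (- 2^-1 : R).
  have /andP[_ +] := va c.
  set e := expR (- (_ * _)) => va1 e1 e2.
  apply: le_trans va1 _; rewrite -mulrA mulrCA ler_peMr ?(ltW a0)//; lra.
set h := `|c - c0| in hD *.
have h0 : 0 < h by exact: lt_trans hD.
(* With this weight on [c], the mixture of [c] and [c0] is at distance [D0] from [c0], where [v] has
   halved; the power [l^-1] turns the halving into exponential decay in [h / D0]. *)
set l := D0 / h.
have l01 : 0 < l < 1 by rewrite divr_gt0//= ltr_pdivrMr// mul1r.
have /andP[l0 l1] := l01.
have H1 : v c `^ l * v c0 `^ (1 - l) <= v c0 * 2^-1.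
  apply: le_trans (lc _ c c0 l01) (half _ _).
  rewrite (_ : _ - c0 = l * (c - c0)); last by ring.
  by rewrite normrM (gtr0_norm l0) /l divfK// lt0r_neq0.
have H2 : v c `^ l <= (v c0) `^ l * 2^-1.
  have p1 : 0 < v c0 `^ (1 - l) by exact: powR_gt0.
  rewrite -(ler_pM2r p1); apply: le_trans H1 _.
  rewrite mulrAC -powRD ?(gt_eqF vc0p) ?implybT//.
  by rewrite addrC subrK powRr1.
have H3 : v c <= v c0 * (2^-1) `^ (l^-1).
  have lV : 0 <= l^-1 by rewrite invr_ge0 ltW.
  have ln0 : l != 0 by exact: lt0r_neq0.
  have := ge0_ler_powR lV _ _ H2.
  rewrite !nnegrE powR_ge0 mulr_ge0 ?powR_ge0 ?invr_ge0// => /(_ isT isT).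
  by rewrite powRM ?powR_ge0 ?invr_ge0// -!powRrM divff// !powRr1.
apply: le_trans H3 _.
have lVE : l^-1 = h / D0 by rewrite /l invf_div.
apply: ler_pM; rewrite ?powR_ge0//.
  by have /andP[_] := va c0; lra.
apply: le_trans (half_powR_le_expR _) _; first by rewrite invr_ge0 ltW.
by rewrite lVE ler_expR lerN2 le_eqVlt; apply/orP; left; apply/eqP; ring.
Qed.

Lemma sum_geom_le (rho : R) N : 0 <= rho < 1 -> \sum_(j < N) rho ^+ j <= (1 - rho)^-1.
Proof.
move=> /andP[r0 r1]; have r1' : 0 < 1 - rho by rewrite subr_gt0.
rewrite -[leRHS]mul1r ler_pdivlMr// mulrC.
by rewrite -opprB mulNr -subrX1 opprB gerBl exprn_ge0.
Qed.

Lemma sum_arith_geom_le (rho : R) N : 0 <= rho < 1 ->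
  \sum_(j < N) j.+1%:R * rho ^+ j <= ((1 - rho) ^+ 2)^-1.
Proof.
move=> /andP[r0 r1]; have r1' : 0 < 1 - rho by rewrite subr_gt0.
have E : (1 - rho) ^+ 2 * \sum_(j < N) j.+1%:R * rho ^+ j =
    1 - N.+1%:R * rho ^+ N + N%:R * rho ^+ N.+1.
  elim: N => [|N IH]; first by rewrite big_ord0 expr0; ring.
  rewrite big_ord_recr/= mulrDr IH !exprS -(addn1 N.+1) -(addn1 N) !natrD; ring.
rewrite -[leRHS]mul1r ler_pdivlMr ?exprn_gt0// mulrC E.
have : N%:R * rho ^+ N.+1 <= N.+1%:R * rho ^+ N.
  apply: ler_pM => //; rewrite ?exprn_ge0// ?ler_nat//.
  by rewrite exprS ler_piMl ?exprn_ge0// ltW.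
lra.
Qed.

(** As ln y < y, the power y^r is at most exp (r y), so an exponent linear in r y absorbs it with a
    [K] independent of [r]. The product [K * r] becomes the stopping radius. *)
Lemma powR_expR_le (theta k : R) : 0 < theta -> 0 < k -> exists2 K : R, 1 <= K &
  forall r y, 1 <= r -> 1 <= y -> y `^ r * expR (- (k * (K * r * y))) <= theta.
Proof.
move=> t0 k0.
pose L : R := `|ln theta|.
have L0 : 0 <= L by rewrite normr_ge0.
have tL : expR (- L) <= theta.
  rewrite -[leRHS](lnK (x := theta)) ?posrE// ler_expR.
  by rewrite lerNl /L -normrN ler_norm.
exists (1 + (1 + L) / k) => [|r y r1 y1].
  by rewrite lerDl divr_ge0 ?addr_ge0// ltW.
have y0 : 0 < y by lra.
have yr : y `^ r <= expR (r * y).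
  rewrite -{1}(lnK (x := y)) ?posrE// -expRM ler_expR mulrC ler_pM2l; last by lra.
  exact/ltW/ln_sublinear.
have ry : 1 <= r * y by rewrite -[leLHS]mulr1 ler_pM.
apply: le_trans _ tL.
apply: (@le_trans _ _ (expR (r * y) * expR (- (k * ((1 + (1 + L) / k) * r * y))))).
  by rewrite ler_pM2r// expR_gt0.
rewrite -expRD ler_expR.
rewrite (_ : _ - _ = - (L * (r * y)) - k * (r * y)); last by field; exact: lt0r_neq0.
have : L * 1 <= L * (r * y) by rewrite ler_wpM2l.
have : 0 <= k * (r * y) by rewrite mulr_ge0 ?ltW//; lra.
lra.
Qed.

(* The indicator of [y <= t <= y + 2] is at most the increment over [t, t + 1]
   of the truncation of [t - y] to the interval from 0 to 3; then telescope. *)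
Lemma sum_window_le (y c : R) N :
  \sum_(j < N) ((y <= c + j%:R <= y + 2)%R%:R : R) <= 3.
Proof.
pose phi (t : R) : R := Num.min 3 (Num.max 0 (t - y)).
have phi3 t : 0 <= phi t <= 3.
  by rewrite /phi le_min ge_min le_max !lexx ler0n.
have step t : (y <= t <= y + 2)%R%:R <= phi (t + 1) - phi t.
  rewrite /phi !maxEle; case: (boolP (y <= t <= y + 2)) => [/andP[h1 h2]|_] /=;
    do ?[case: ifPn; rewrite -?ltNge => ?]; rewrite !minEle;
    by do ?[case: ifPn; rewrite -?ltNge => ?]; lra.
have S (n : nat) : \sum_(j < n) ((y <= c + j%:R <= y + 2)%R%:R : R) <= phi (c + n%:R) - phi c.
  elim: n => [|n IH]; first by rewrite big_ord0 addr0 subrr.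
  rewrite big_ord_recr/=.
  have := step (c + n%:R); rewrite -addrA [n%:R + 1]natr1; lra.
have := S N; have := phi3 (c + N%:R); have := phi3 c; lra.
Qed.

End real_estimates.

(** * The r-norm and its duality, up to factors 2 *)

Section pnorm.
Context (R : realType) (n : nat).
Implicit Types (r : R) (x y c : 'I_n -> R).

Definition pnorm r x : R := (\sum_i `|x i| `^ r) `^ r^-1.

Lemma pnorm_ge0 r x : 0 <= pnorm r x.
Proof. exact: powR_ge0. Qed.

Let sum_ge0 r x : 0 <= \sum_i `|x i| `^ r.
Proof. by rewrite sumr_ge0// => i _; exact: powR_ge0. Qed.

Lemma powR_pnorm r x : 0 < r -> pnorm r x `^ r = \sum_i `|x i| `^ r.
Proof. by move=> r0; rewrite -powRrM mulVf ?lt0r_neq0// powRr1. Qed.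

Lemma ler_pnorm r x y : 0 < r -> (forall i, `|x i| <= `|y i|) -> pnorm r x <= pnorm r y.
Proof.
move=> r0 xy; apply: ge0_ler_powR; rewrite ?nnegrE ?invr_ge0 ?(ltW r0)//.
by apply: ler_sum => i _; apply: ge0_ler_powR; rewrite ?nnegrE ?(ltW r0).
Qed.

Lemma pnorm_le_powR r x b : 0 < r -> 0 <= b ->
  \sum_i `|x i| `^ r <= b `^ r -> pnorm r x <= b.
Proof.
move=> r0 b0 H; rewrite -[leRHS]powRr1// -(divff (lt0r_neq0 r0)) powRrM.
by apply: ge0_ler_powR; rewrite ?nnegrE ?invr_ge0 ?(ltW r0) ?powR_ge0.
Qed.

Lemma ler_coord_pnorm r x i : 0 < r -> `|x i| <= pnorm r x.
Proof.
move=> r0; rewrite -[leLHS]powRr1// -(divff (lt0r_neq0 r0)) powRrM.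
apply: ge0_ler_powR; rewrite ?nnegrE ?invr_ge0 ?(ltW r0) ?powR_ge0//.
by rewrite (bigD1 i)//= lerDl sumr_ge0// => j _; exact: powR_ge0.
Qed.

(** The factor [n] is crude, but it will only multiply a parameter that tends to 0. *)
Lemma pnorm_cst_le r (b : R) : 1 <= r -> pnorm r (fun=> b) <= `|b| * n%:R.
Proof.
move=> r1; have r0 : 0 < r by exact: lt_le_trans r1.
have b0 : 0 <= `|b| * n%:R by rewrite mulr_ge0.
apply: pnorm_le_powR => //.
rewrite sumr_const card_ord -[leLHS]mulr_natr powRM// ler_wpM2l ?powR_ge0//.
case: n => [|m]; first by rewrite powR0 ?lt0r_neq0.
by apply: le1r_powR => //; rewrite ler1n.
Qed.

(** The factor 2 spares Minkowski's inequality: |x_i + y_i| is at most twice the larger of |x_i| and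
    |y_i|, and a^r + b^r is at most (a + b)^r. *)
Lemma pnorm_quasi_triangle r x y : 1 <= r ->
  pnorm r (fun i => x i + y i) <= 2 * (pnorm r x + pnorm r y).
Proof.
move=> r1; have r0 : 0 < r by exact: lt_le_trans r1.
have p0 := pnorm_ge0 r.
have b0 : 0 <= 2 * (pnorm r x + pnorm r y) by rewrite mulr_ge0// addr_ge0.
apply: pnorm_le_powR => //.
apply: (@le_trans _ _ (2 `^ r * \sum_i (`|x i| `^ r + `|y i| `^ r))).
  rewrite mulr_sumr; apply: ler_sum => i _.
  wlog xy : x y {b0} / `|x i| <= `|y i|.
    move=> H; have [/H//|/ltW/H] := leP `|x i| `|y i|.
    by rewrite addrC [X in _ -> _ <= _ * X]addrC.
  apply: (@le_trans _ _ ((2 * `|y i|) `^ r)).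
    apply: ge0_ler_powR; rewrite ?nnegrE ?(ltW r0) ?mulr_ge0//.
    by apply: le_trans (ler_normD _ _) _; rewrite mulr_natl mulr2n lerD2r.
  by rewrite powRM// ler_wpM2l ?powR_ge0// lerDr powR_ge0.
rewrite powRM ?addr_ge0// ler_wpM2l ?powR_ge0// big_split/= -!powR_pnorm//.
move: (pnorm r x) (pnorm r y) (p0 x) (p0 y) => {b0} a b a0 b0.
rewrite -!(mulr_powRB1 _ r0) ?addr_ge0// mulrDl.
have le u v : 0 <= u -> u <= v -> u `^ (r - 1) <= v `^ (r - 1).
  move=> u0 uv; apply: ge0_ler_powR; rewrite ?nnegrE ?subr_ge0//.
  exact: le_trans uv.
by apply: lerD; rewrite ler_wpM2l// le// ?lerDl ?lerDr.
Qed.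

Let quasi_young r (g e c y : R) : 0 < r - 1 -> 0 < g -> 0 < e -> 0 <= c -> 0 <= y ->
  c `^ (r - 1) * y <= e / g * c `^ r + (g / e) `^ (r - 1) * y `^ r.
Proof.
move=> r1 g0 e0 c0 y0.
have r0 : 0 < r by lra.
have eg : 0 < e / g by rewrite divr_gt0.
have ge : 0 < g / e by rewrite divr_gt0.
have cr : c `^ r = c `^ (r - 1) * c by rewrite -mulr_powRB1// mulrC.
have yr : y `^ r = y `^ (r - 1) * y by rewrite -mulr_powRB1// mulrC.
have [h|h] := leP y (e / g * c).
  apply: (@le_trans _ _ (e / g * c `^ r)).
    by rewrite cr mulrCA ler_wpM2l ?powR_ge0.
  by rewrite lerDl mulr_ge0 ?powR_ge0.
apply: (@le_trans _ _ ((g / e) `^ (r - 1) * y `^ r)).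
  rewrite yr mulrA ler_wpM2r// -powRM ?(ltW ge)//.
  have gey : 0 <= g / e * y by rewrite mulr_ge0// ltW.
  apply: ge0_ler_powR; rewrite ?nnegrE ?(ltW r1)//.
  have cE : c = g / e * (e / g * c) by field; rewrite !lt0r_neq0.
  by rewrite [leLHS]cE ler_wpM2l ?(ltW ge) ?(ltW h).
by rewrite lerDr mulr_ge0 ?powR_ge0// ltW.
Qed.

(* A cheap form of Hoelder's inequality: split the sum according to which of
   [`|y i| / pnorm r y] and [`|c i| / pnorm r c] is the larger. *)
Lemma quasi_hoelder r c y : 1 <= r ->
  \sum_i `|c i| `^ (r - 1) * `|y i| <= 2 * pnorm r c `^ (r - 1) * pnorm r y.
Proof.
move=> r1; have r0 : 0 < r by exact: lt_le_trans r1.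
have p0 x : 0 <= pnorm r x by exact: pnorm_ge0.
have z0 x i : pnorm r x = 0 -> x i = 0.
  move=> h; apply/eqP; rewrite -normr_le0 -h; exact: ler_coord_pnorm.
have [y0|yn0] := eqVneq (pnorm r y) 0.
  rewrite y0 mulr0 big1// => i _; by rewrite (z0 _ i y0) normr0 mulr0.
have yp : 0 < pnorm r y by rewrite lt0r yn0 p0.
have [r1E|rn1] := eqVneq r 1.
  subst r; rewrite subrr powRr0 mulr1 /pnorm invr1 powRr1//.
  rewrite (eq_bigr (fun i => `|y i| `^ 1)) ?mulr_natl ?mulr2n ?lerDl// => i _.
  by rewrite powRr0 mul1r powRr1.
have r1' : 0 < r - 1 by rewrite subr_gt0 lt_neqAle eq_sym rn1.
have [c0|cn0] := eqVneq (pnorm r c) 0.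
  rewrite c0 powR0 ?lt0r_neq0// mulr0 mul0r big1// => i _.
  by rewrite (z0 _ i c0) normr0 powR0 ?mul0r// lt0r_neq0.
have cp : 0 < pnorm r c by rewrite lt0r cn0 p0.
apply: le_trans (ler_sum _ (fun i _ =>
  quasi_young r1' cp yp (normr_ge0 (c i)) (normr_ge0 (y i)))) _.
rewrite big_split/= -!mulr_sumr -!powR_pnorm//.
move: (pnorm r c) (pnorm r y) cp yp => g e g0 e0.
have -> : g `^ r = g * g `^ (r - 1) by rewrite mulr_powRB1// ltW.
have -> : e `^ r = e * e `^ (r - 1) by rewrite mulr_powRB1// ltW.
rewrite powRM ?(ltW g0) ?invr_ge0 ?(ltW e0)//.
have -> : e^-1 `^ (r - 1) = (e `^ (r - 1))^-1.
  by rewrite -powR_inv1 ?(ltW e0)// -powRrM mulN1r powRN.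
have := powR_gt0 (r - 1) e0; move: (e `^ (r - 1)) (g `^ (r - 1)) => a b a0.
rewrite le_eqVlt; apply/orP; left; apply/eqP; field.
by rewrite !lt0r_neq0.
Qed.

(** The classical extremal vector sg(c_i) |c_i|^(r-1) / |c|_r^(r-1), which for r = 1 is the sign
    vector. The last clause stands in for Hoelder's inequality against [t]. *)
Lemma norming_vector r c : 1 <= r ->
  exists t : 'rV[R]_n, [/\ lnorm (hoelder_conjugate r%:E) t <= 1,
    \sum_i t ord0 i * c i = pnorm r c &
    forall y, \sum_i `|t ord0 i| * `|y i| <= 2 * pnorm r y].
Proof.
move=> r1; have r0 : 0 < r by exact: lt_le_trans r1.
have [c0|cn0] := eqVneq (pnorm r c) 0.
  exists 0; split.
  - case: hoelder_conjugate => [s| |] /=; rewrite ?ler01//.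
      have [->|s0] := eqVneq s 0; first by rewrite invr0 powRr0.
      rewrite big1 ?powR0 ?ler01 ?invr_eq0// => i _.
      by rewrite mxE normr0 powR0.
    by apply: bigmax_le => // i _; rewrite mxE normr0.
  - by rewrite c0 big1// => i _; rewrite mxE mul0r.
  - by move=> y; rewrite big1 ?mulr_ge0 ?pnorm_ge0// => i _; rewrite mxE normr0 mul0r.
have cp : 0 < pnorm r c by rewrite lt0r cn0 pnorm_ge0.
have [g gE] : exists g, g = pnorm r c `^ (r - 1) by exists (pnorm r c `^ (r - 1)).
have gp : 0 < g by rewrite gE powR_gt0.
pose t : 'rV[R]_n := \row_i (Num.sg (c i) * `|c i| `^ (r - 1) / g).
have tle i : `|t ord0 i| <= `|c i| `^ (r - 1) / g.
  rewrite mxE !normrM normfV (gtr0_norm gp) ler_wpM2r ?invr_ge0 ?(ltW gp)//.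
  rewrite (ger0_norm (powR_ge0 _ _)) ler_piMl ?powR_ge0//.
  by rewrite normr_sg; case: (c i == 0).
exists t; split.
- have [r1E|rn1] := eqVneq r 1.
    rewrite r1E hoelder_conjugate1 /=; apply: bigmax_le => // i _.
    by apply: le_trans (tle i) _; rewrite gE r1E subrr !powRr0 divr1.
  have r1' : 0 < r - 1 by rewrite subr_gt0 lt_neqAle eq_sym rn1.
  have -> : hoelder_conjugate r%:E = (r / (r - 1))%:E.
    rewrite /hoelder_conjugate/= eqe gt_eqF// -EFinB inver gt_eqF//.
  have [s sE] : exists s, s = r / (r - 1) by exists (r / (r - 1)).
  rewrite -sE; have s0 : 0 < s by rewrite sE divr_gt0.
  apply: (@pnorm_le_powR s (fun i => t ord0 i)) => //; rewrite powR1.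
  have rs : (r - 1) * s = r by rewrite sE mulrC divfK// lt0r_neq0.
  have grE : g `^ s = pnorm r c `^ r.
    by rewrite gE -powRrM rs.
  apply: (@le_trans _ _ (\sum_i `|c i| `^ r / g `^ s)).
    apply: ler_sum => i _.
    apply: (@le_trans _ _ ((`|c i| `^ (r - 1) / g) `^ s)).
      have q0 : 0 <= `|c i| `^ (r - 1) / g by rewrite divr_ge0 ?powR_ge0 ?(ltW gp).
      by apply: ge0_ler_powR; rewrite ?nnegrE ?(ltW s0).
    rewrite powRM ?powR_ge0 ?invr_ge0 ?(ltW gp)// -powRrM rs.
    by rewrite -(powR_inv1 (ltW gp)) -powRrM mulN1r powRN.
  by rewrite -mulr_suml grE powR_pnorm// divff// -powR_pnorm// powR_eq0 negb_and cn0.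
- rewrite -[RHS](mulfK (lt0r_neq0 gp)).
  rewrite {1}gE mulr_powRB1 ?(ltW cp)// powR_pnorm// mulr_suml.
  apply: eq_bigr => i _; rewrite mxE.
  have -> : `|c i| `^ r = `|c i| * `|c i| `^ (r - 1) by rewrite mulr_powRB1.
  move: (`|c i| `^ (r - 1)) => a.
  by rewrite normrEsg; ring.
- move=> y.
  apply: (@le_trans _ _ (\sum_i g^-1 * (`|c i| `^ (r - 1) * `|y i|))).
    by apply: ler_sum => i _; rewrite mulrA ler_wpM2r// mulrC.
  rewrite -mulr_sumr ler_pdivrMl//; apply: le_trans (quasi_hoelder _ _ r1) _.
  by rewrite -gE mulrAC mulrC.
Qed.

End pnorm.

(** * Unit cells, words and path weights *)

Section ranges.
Context (R : realType).

(** Left ends of the unit cells that cover the interval (-N, N); the shift by one in the negative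
    half avoids a second 0. *)
Definition rng (N : nat) : seq R :=
  [seq j%:R | j <- iota 0 N] ++ [seq - j.+1%:R | j <- iota 0 N].

Lemma big_rng N (F : R -> R) :
  \sum_(c <- rng N) F c = \sum_(j < N) F j%:R + \sum_(j < N) F (- j.+1%:R).
Proof.
by rewrite big_cat !big_map -[N in iota 0 N]subn0 -/(index_iota 0 N) !big_mkord.
Qed.

Lemma rng_cover N (x : R) : `|x| < N%:R -> exists2 c, c \in rng N & c <= x <= c + 1.
Proof.
move=> xN; have [x0|x0] := leP 0 x.
  exists (Num.truncn x)%:R.
    rewrite mem_cat map_f// mem_iota/= add0n -(ltr_nat R).
    by apply: le_lt_trans xN; rewrite ger0_norm// truncn_le.
  by rewrite truncn_le x0/= natr1 ltW// truncnS_gt.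
have nx0 : 0 <= - x by rewrite oppr_ge0 ltW.
have /andP[h1 h2] := truncn_itv nx0.
exists (- (Num.truncn (- x)).+1%:R).
  rewrite mem_cat (map_f (fun j => - j.+1%:R)) ?orbT// mem_iota/= add0n -(ltr_nat R).
  by apply: le_lt_trans xN; rewrite ltr0_norm.
by move: h1 h2; rewrite -natr1; lra.
Qed.

(** Three for each half of the range. The resulting 6 is the base of the overlap bound for midpoint
    boxes. *)
Lemma sum_rng_window N (y : R) : \sum_(c <- rng N) ((y <= c <= y + 2)%R%:R : R) <= 6.
Proof.
rewrite big_rng.
have h1 : \sum_(j < N) ((y <= j%:R <= y + 2)%R%:R : R) <= 3.
  by have := sum_window_le y 0 N; under eq_bigr do rewrite add0r.
have h2 := sum_window_le (- y - 2) 1 N.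
rewrite (_ : 6 = 3 + 3); last by ring.
apply: lerD => //; apply: le_trans h2; apply: ler_sum => j _.
rewrite ler_nat.
case: (boolP (y <= - j.+1%:R <= y + 2)) => // /andP[a b].
rewrite lt0b; apply/andP; move: a b; rewrite -natr1; split; lra.
Qed.

Definition expsum_bound : R := 2 / (1 - expR (-1)).

Lemma sum_rng_expR N : \sum_(c <- rng N) expR (- `|c|) <= expsum_bound.
Proof.
have e1 : 0 <= expR (-1 : R) < 1 by rewrite expR_ge0/= expR_lt1 ltrN10.
have geom := sum_geom_le N e1.
rewrite big_rng /expsum_bound mulr_natl mulr2n; apply: lerD.
  apply: le_trans geom; apply: ler_sum => j _.
  by rewrite ger0_norm// -expRM_natl mulrN1.
apply: le_trans geom; apply: ler_sum => j _.
rewrite -expRM_natl mulrN1 ler_expR lerN2 normrN ger0_norm// ler_nat//.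
Qed.

Lemma ler_sum_seq1 (I : eqType) (r : seq I) (F : I -> R) i :
  (forall j, 0 <= F j) -> i \in r -> F i <= \sum_(j <- r) F j.
Proof. by move=> F0 ir; rewrite (big_rem _ ir)/= lerDl sumr_ge0. Qed.

End ranges.

Section words.
Context (R : realType) (S : Type) (A : seq S).

(** Letters are added in front, so the tail of a word is the parent of the node that it names. *)
Fixpoint words (k : nat) : seq (seq S) :=
  if k is k'.+1 then [seq s :: u | u <- words k', s <- A] else [:: [::]].

Lemma big_words k (F : seq S -> R) :
  \sum_(u <- words k.+1) F u = \sum_(u <- words k) \sum_(s <- A) F (s :: u).
Proof. exact: big_allpairs_dep. Qed.

End words.

Section path_weight.
Context (R : realType) (S : Type) (q : seq S -> S -> R).

(** [q v t] belongs to the edge from [v] to [t :: v], so a weight may depend on the whole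
    history. *)
Fixpoint path_weight (u : seq S) : R :=
  if u is t :: v then q v t * path_weight v else 1.

Lemma path_weight_ge0 u : (forall v t, 0 <= q v t) -> 0 <= path_weight u.
Proof. by move=> q0; elim: u => //= t u IH; rewrite mulr_ge0. Qed.

End path_weight.

Lemma size_words (S : eqType) (A : seq S) k u : u \in words A k -> size u = k.
Proof.
elim: k u => [|k IH] u /=; first by rewrite inE => /eqP ->.
by move=> /allpairsP[[v s] /= [vk _ ->]] /=; rewrite IH.
Qed.

Lemma Pr_markov d (T : measurableType d) (R : realType) (P : probability T R)
    (Y : T -> R) (a m : R) : measurable_fun setT Y -> (forall w, 0 <= Y w) -> 0 <= a ->
  (\int[P]_w (Y w)%:E <= m%:E)%E -> a * Pr P [set w | a <= Y w] <= m.
Proof.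
move=> mY Y0 a0; rewrite -lee_fin; apply: le_trans.
have mE := measurable_superlevel mY a.
have := @integral_step d T R P unit [:: tt] (fun=> a) (fun=> [set w | a <= Y w])
  (fun=> a0) (fun=> mE).
rewrite big_seq1 => <-; apply: ge0_le_integral => //.
- by move=> w _; rewrite big_seq1 lee_fin mulr_ge0.
- by apply/measurable_EFinP; apply: measurable_step.
- exact/measurable_EFinP.
- move=> w _; rewrite big_seq1 lee_fin indicE.
  by case: (boolP (w \in _)) => [|_]; rewrite ?mulr0// inE/= mulr1.
Qed.

(** * Boxes cut out by slabs, and the overlap of midpoint boxes *)

Section boxes.
Context d (T : measurableType d) (R : realType) (P : probability T R) (n : nat).
Context (X : 'I_n -> {RV P >-> R}) (D : 'I_n -> R).
Context (hX : log_concave X) (D0 : forall i, 0 < D i).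
Local Notation step := ('I_n * R)%type.

(* A step [(i, c)] records that [X i / D i] lies between [c] and [c + 1]. Slabs
   are closed, so that log-concavity applies to them; their common boundaries
   are counted twice, which is harmless in upper bounds. *)
Definition slab (s : step) : set 'rV[R]_n :=
  [set x | s.2 * D s.1 <= x ord0 s.1 <= (s.2 + 1) * D s.1].

Fixpoint box (u : seq step) : set 'rV[R]_n :=
  if u is s :: v then slab s `&` box v else setT.

Definition boxev (u : seq step) : set T := random_row X @^-1` box u.
Definition box_prob (u : seq step) : R := Pr P (boxev u).
Local Notation V := box_prob.

Lemma boxev_cons i c u w :
  boxev ((i, c) :: u) w <-> (c <= X i w / D i <= c + 1) /\ boxev u w.
Proof. by rewrite ler_pdivlMr// ler_pdivrMr// /boxev/= /slab/= mxE. Qed.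

Lemma closed_slab s : closed (slab s).
Proof.
have -> : slab s = (fun x : 'rV[R]_n => x ord0 s.1) @^-1`
    `[s.2 * D s.1, (s.2 + 1) * D s.1]%classic.
  by apply/seteqP; split => x /=; rewrite in_itv.
apply: closed_comp => [x _|]; first exact: coord_continuous.
exact: itv_closed.
Qed.

Lemma closed_box u : closed (box u).
Proof.
elim: u => [|s u IH] /=; first exact: closedT.
by apply: closedI => //; exact: closed_slab.
Qed.

Lemma measurable_boxev u : measurable (boxev u).
Proof. by apply: measurable_random_row_closed; exact: closed_box. Qed.

Lemma slab_conv (l : R) i c c' x y : 0 < l < 1 -> slab (i, c) x -> slab (i, c') y ->
  slab (i, l * c + (1 - l) * c') (l *: x + (1 - l) *: y).
Proof.
move=> /andP[l0 l1]; rewrite /slab /= !mxE => /andP[a b] /andP[a' b'].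
have l1' : 0 <= 1 - l by lra.
have := ler_wpM2l (ltW l0) a; have := ler_wpM2l (ltW l0) b.
have := ler_wpM2l l1' a'; have := ler_wpM2l l1' b'.
move=> h1 h2 h3 h4; apply/andP; split; lra.
Qed.

Lemma box_conv (l : R) u x y : 0 < l < 1 -> box u x -> box u y ->
  box u (l *: x + (1 - l) *: y).
Proof.
move=> l01; elim: u => [|[i c] u IH]//= [sx bx] [sy by_]; split; last exact: IH.
have := slab_conv l01 sx sy.
by rewrite (_ : l * c + _ = c)//; ring.
Qed.

Lemma box_prob_ge0 u : 0 <= V u. Proof. exact: Pr_ge0. Qed.

Lemma box_prob_cons_le s u : V (s :: u) <= V u.
Proof.
by apply: le_Pr; [exact: measurable_boxev|exact: measurable_boxev|move=> w []].
Qed.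

Lemma box_prob_nil : V [::] = 1.
Proof. by rewrite /box_prob /boxev /= preimage_setT PrT. Qed.

Lemma box_prob_le1 u : V u <= 1.
Proof. by apply: Pr_le1; exact: measurable_boxev. Qed.

(** Positions are arbitrary reals, so that the mass of a slab is a log-concave function of its
    position, as [slab_tail] requires. *)
Lemma box_prob_conv u i (l c c' : R) : 0 < l < 1 ->
  V ((i, c) :: u) `^ l * V ((i, c') :: u) `^ (1 - l)
    <= V ((i, l * c + (1 - l) * c') :: u).
Proof.
move=> l01; apply: log_concave_closed => //; try exact: closed_box.
  exact: measurable_boxev.
move=> x y [sx bx] [sy by_]; split; last exact: box_conv.
exact: slab_conv.
Qed.

(** Slabs have width 1 in units of [D i], so with gaps of at least 2 no point lies in two of them,
    although they are closed. *)
Lemma box_prob_disjoint u i c (N : nat) (delta : R) : 2 <= `|delta| ->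
  \sum_(j < N) V ((i, c + j%:R * delta) :: u) <= V u.
Proof.
move=> d2.
have := @le_Pr_step d T R P 'I_N unit (index_enum _) [:: tt] (fun=> 1) (fun=> 1)
  (fun j : 'I_N => boxev ((i, c + j%:R * delta) :: u)) (fun=> boxev u) (fun=> ler01)
  (fun=> measurable_boxev _) (fun=> ler01) (fun=> measurable_boxev _).
rewrite big_seq1 mul1r; under eq_bigr do rewrite mul1r; apply => w.
rewrite big_seq1 mul1r; under eq_bigr do rewrite mul1r.
have [|none] := pselect (exists j : 'I_N, boxev ((i, c + j%:R * delta) :: u) w); last first.
  rewrite big1// => j _; rewrite indicE memNset// => h; apply: none; by exists j.
move=> [j hj]; rewrite (bigD1 j)//= big1 ?addr0.
  by rewrite !indicE !mem_set//; case: hj.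
move=> k kj; rewrite indicE memNset// => /boxev_cons[/andP[a' b'] _].
have [/andP[a b] _] := (boxev_cons _ _ _ _).1 hj.
have : `|(j%:R - k%:R) * delta| <= 1 by rewrite ler_norml; apply/andP; split; lra.
have gap (p q : nat) : (p < q)%N -> (1 : R) <= `|p%:R - q%:R|.
  move=> pq; have : p.+1%:R <= q%:R :> R by rewrite ler_nat.
  by rewrite -natr1 distrC => h; apply: le_trans (ler_norm _); lra.
have : (1 : R) <= `|j%:R - k%:R|.
  have [/gap//|/gap|/val_inj/eqP] := ltngtP (j : nat) k.
    by rewrite distrC.
  by rewrite eq_sym (negbTE kj).
rewrite normrM => h1 h2.
have : 1 * 2 <= `|j%:R - k%:R| * `|delta| by apply: ler_pM.
lra.
Qed.

Fixpoint relabel (u : seq step) (b : seq R) : seq step :=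
  match u, b with s :: v, c :: b' => (s.1, c) :: relabel v b' | _, _ => [::] end.

Fixpoint midway (u : seq step) (b : seq R) : seq step :=
  match u, b with
  | s :: v, c :: b' => (s.1, (s.2 + c) / 2) :: midway v b'
  | _, _ => [::]
  end.

Lemma box_prob_midway u b : V u `^ 2^-1 * V (relabel u b) `^ 2^-1 <= V (midway u b).
Proof.
have h1 : 1 - 2^-1 = 2^-1 :> R by field.
have h01 : 0 < (2^-1 : R) < 1 by lra.
have := @log_concave_closed d T R P n X (box u) (box (relabel u b)) (box (midway u b)) 2^-1 hX h01
  (@closed_box u) (@closed_box _) (measurable_boxev _).
rewrite h1; apply => x y; elim: u b => [|[i c] u IH] [|c' b] //= [sx bx] [sy by_].
split; last exact: IH.
have := slab_conv h01 sx sy; rewrite h1.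
by rewrite (_ : _ * c + _ = (c + c') / 2)//; field.
Qed.

Section entropy.
Context (om : seq step -> 'I_n -> R).
Context (om0 : forall u i, 0 <= om u i) (om1 : forall u, \sum_i om u i <= 1).

Definition steps (M : nat) : seq step := [seq (i, c) | i <- enum 'I_n, c <- rng R M].

Lemma big_steps M (F : step -> R) :
  \sum_(s <- steps M) F s = \sum_i \sum_(c <- rng R M) F (i, c).
Proof. by rewrite big_allpairs big_enum. Qed.

Local Notation wom := (path_weight (fun v t => om v t.1)).

Let wom_ge0 u : 0 <= wom u. Proof. exact: path_weight_ge0. Qed.

(** Peel off the last step. For a fixed coordinate [i] and point [w], only positions in a window of
    length 2 give a midpoint slab that contains [w], hence at most 6; the weights [om u i] then sum
    to at most 1 over [i], however they depend on [u]. *)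
Lemma overlap M k b w : size b = k ->
  \sum_(u <- words (steps M) k) wom u * \1_(boxev (midway u b)) w <= 6 ^+ k.
Proof.
elim: k b => [|k IH] [|c b]// => [_|[/IH H]].
  by rewrite big_seq1 /= mul1r expr0 indicE; case: (_ \in _).
rewrite big_words exprS mulrC; apply: le_trans (ler_wpM2r _ H); last by [].
rewrite mulr_suml; apply: ler_sum => u _.
rewrite big_steps.
apply: (@le_trans _ _ (\sum_i om u i * 6 * (wom u * \1_(boxev (midway u b)) w))).
  apply: ler_sum => i _ /=.
  (* With x = X i w / D i, the condition (c' + c) / 2 <= x <= (c' + c) / 2 + 1 reads 2 x - c - 2 <=
     c' <= 2 x - c. *)
  apply: (@le_trans _ _ (\sum_(c' <- rng R M) om u i * (wom u * \1_(boxev (midway u b)) w)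
     * ((2 * (X i w / D i) - c - 2 <= c' <= 2 * (X i w / D i) - c - 2 + 2)%R%:R))).
    apply: ler_sum => c' _.
    rewrite -mulrA -mulrA ler_wpM2l// -mulrA ler_wpM2l ?wom_ge0// !indicE.
    case: (boolP (w \in boxev ((i, (c' + c) / 2) :: midway u b))); last first.
      by move=> _; rewrite mulr_ge0.
    rewrite inE => /boxev_cons[/andP[h1 h2] h3]; rewrite (mem_set h3) mul1r.
    by rewrite (_ : (_ <= _ <= _) = true)//; apply/andP; split; lra.
  rewrite -mulr_sumr mulrAC ler_wpM2r//; first by rewrite mulr_ge0 ?wom_ge0.
  by rewrite ler_wpM2l ?sum_rng_window.
rewrite -mulr_suml -mulr_suml.
have z0 : 0 <= wom u * \1_(boxev (midway u b)) w by rewrite mulr_ge0 ?wom_ge0.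
by rewrite [leRHS]mulrC ler_wpM2r// ler_piMl.
Qed.

Lemma overlap_Pr M k b : size b = k ->
  \sum_(u <- words (steps M) k) wom u * V (midway u b) <= 6 ^+ k.
Proof.
move=> bk.
have := @le_Pr_step d T R P _ unit (words (steps M) k) [:: tt] wom (fun=> 6 ^+ k)
  (fun u => boxev (midway u b)) (fun=> setT) wom_ge0
  (fun=> measurable_boxev _) (fun=> _) (fun=> measurableT).
rewrite big_seq1 PrT mulr1; apply => [|w]; first by rewrite exprn_ge0.
rewrite big_seq1 indicE in_setT mulr1; exact: overlap.
Qed.

End entropy.
End boxes.

(** * Entropy of a generation of the tree *)

Section entropy_bound.
Context d (T : measurableType d) (R : realType) (P : probability T R) (n : nat).
Context (X : 'I_n -> {RV P >-> R}) (D : 'I_n -> R).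
Context (hX : log_concave X) (D0 : forall i, 0 < D i).
Context (EX : forall i, (\int[P]_w (`|X i w|%:E) <= (D i)%:E)%E).
Local Notation step := ('I_n * R)%type.
Local Notation V := (box_prob X D).
Local Notation boxev := (boxev X D).

(** Size of the point along the coordinates of [u], with repetition; its mean is at most the length
    of [u]. *)
Let Y (u : seq step) (w : T) : R := \sum_(s <- u) `|X s.1 w / D s.1|.

Let mY u : measurable_fun setT (Y u).
Proof.
apply: measurable_sum => s; apply: measurableT_comp => //.
by apply: measurable_funM.
Qed.

Let Y_ge0 u w : 0 <= Y u w. Proof. by rewrite sumr_ge0. Qed.

Let integral_Y u : (\int[P]_w (Y u w)%:E <= (size u)%:R%:E)%E.
Proof.
rewrite /Y; under eq_integral do rewrite -sumEFin.
have mZ (s : step) : measurable_fun setT (fun w => (`|X s.1 w / D s.1|)%:E).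
  by apply/measurable_EFinP; apply: measurableT_comp => //; exact: measurable_funM.
rewrite (ge0_integral_sum _ measurableT mZ)//.
apply: (@le_trans _ _ (\sum_(s <- u) 1%E)); last first.
  by rewrite sumEFin lee_fin big_const_seq count_predT iter_addr_0.
apply: lee_sum => s _.
under eq_integral do rewrite normrM mulrC normfV (gtr0_norm (D0 _)) EFinM.
have Di0 : 0 <= (D s.1)^-1 by rewrite invr_ge0 ltW.
rewrite ge0_integralZl_EFin//; last by apply/measurable_EFinP; apply: measurableT_comp.
apply: (@le_trans _ _ ((D s.1)^-1%:E * (D s.1)%:E)%E).
  by apply: lee_wpmul2l; rewrite ?lee_fin ?EX.
by rewrite -EFinM mulVf// lt0r_neq0.
Qed.

(** Markov's inequality; the summand 1 covers the empty word. *)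
Let small_Y u : 2^-1 <= Pr P [set w | Y u w < 2 * (size u)%:R + 1].
Proof.
set a := _ + 1; have a1 : 1 <= a by rewrite lerDr mulr_ge0.
have mE := measurable_superlevel (mY u) a.
have -> : [set w | Y u w < a] = ~` [set w | a <= Y u w].
  by apply/seteqP; split => w /=; rewrite ltNge => /negP.
rewrite Pr_setC//.
have a0 : 0 <= a by lra.
have := Pr_markov (mY u) (Y_ge0 u) a0 (integral_Y u).
have := Pr_ge0 P [set w | a <= Y u w].
set p := Pr _ _; rewrite /a; have : 0 <= (size u)%:R :> R by [].
move: (size u)%:R => k; nra.
Qed.

(** Unnormalised law of independent integer positions with exponential tails. Its total mass is at
    most geometric in the length, whatever the range. *)
Let gb (b : seq R) : R := \prod_(c <- b) expR (- `|c|).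

Let gb_ge0 b : 0 <= gb b.
Proof. by apply: prodr_ge0 => c _; exact: expR_ge0. Qed.

Let gb_cons c b : gb (c :: b) = expR (- `|c|) * gb b.
Proof. by rewrite /gb big_cons. Qed.

Let sum_gb N k : \sum_(b <- words (rng R N) k) gb b <= expsum_bound R ^+ k.
Proof.
have G0 : 0 <= expsum_bound R by apply: le_trans (sum_rng_expR R 0); rewrite big_nil.
elim: k => [|k IH]; first by rewrite big_seq1 /gb big_nil expr0.
rewrite big_words exprSr.
apply: (@le_trans _ _ (\sum_(u <- words (rng R N) k) gb u * expsum_bound R)).
  apply: ler_sum => u _; under eq_bigr do rewrite gb_cons mulrC.
  by rewrite -mulr_sumr ler_wpM2l ?gb_ge0// sum_rng_expR.
by rewrite -mulr_suml ler_wpM2r.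
Qed.

(** Take for [b] the cells that contain [w]: the size of each position exceeds that of the
    coordinate by at most 1, whence the term [size u]. *)
Let relabel_cover N u w : (forall s, s \in u -> `|X s.1 w / D s.1| < N%:R) ->
  expR (- (Y u w + (size u)%:R)) <=
  \sum_(b <- words (rng R N) (size u)) gb b * \1_(boxev (relabel u b)) w.
Proof.
elim: u => [_|[i x] u IH Hs].
  rewrite big_seq1 /Y /gb !big_nil add0r oppr0 expR0 mul1r indicE mem_set//.
have {}IH := IH (fun s su => Hs s (@mem_behead _ (_ :: _) _ su)).
have [c cN /= cx] := rng_cover (Hs _ (mem_head _ _)).
change (size ((i, x) :: u)) with (size u).+1.
rewrite big_words /Y big_cons -/(Y u w) -natr1.
rewrite (_ : - _ = - (`|X i w / D i| + 1) + - (Y u w + (size u)%:R)); last by rewrite /=; ring.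
rewrite expRD; apply: le_trans (ler_wpM2l (expR_ge0 _) IH) _.
rewrite mulr_sumr; apply: ler_sum => b _.
apply: (le_trans _ (ler_sum_seq1 _ cN)) => [|c']; last by rewrite mulr_ge0.
rewrite gb_cons mulrA.
have -> : \1_(boxev ((i, c) :: relabel u b)) w = \1_(boxev (relabel u b)) w :> R.
  rewrite !indicE; congr (_%:R); congr nat_of_bool.
  apply/idP/idP; rewrite !inE; first by case/(boxev_cons X D0).
  by move=> h; apply/(boxev_cons X D0).
rewrite ler_wpM2r// ler_wpM2r// ler_expR.
rewrite lerN2; case/andP: cx => c1 c2.
have := ler_norm (X i w / D i); have := ler_norm (- (X i w / D i)); rewrite normrN.
move: (`|X i w / D i|) => z z1 z2.
by rewrite ler_norml; apply/andP; split; lra.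
Qed.

(** With probability at least one half the point has size below 2 k + 1 along [u], and then the
    cells around it have weight at least exp (- (3 k + 1)). This loss becomes the factor [expR 3] of
    [entropy_cst]. *)
Let relabel_lower u : expR (- (3 * (size u)%:R + 1)) / 2 <=
  \sum_(b <- words (rng R (2 * size u).+1) (size u)) gb b * V (relabel u b).
Proof.
set k := (size u)%:R; set e := expR _.
have e0 : 0 <= e by exact: expR_ge0.
pose E : set T := [set w | Y u w < 2 * k + 1].
have mE : measurable E by exact: measurable_strict_sublevel (mY u) _.
apply: (@le_trans _ _ (e * Pr P E)); first by rewrite ler_wpM2l// small_Y.
have := @le_Pr_step d T R P unit _ [:: tt] (words (rng R (2 * size u).+1) (size u))
  (fun=> e) gb (fun=> E) (fun b => boxev (relabel u b)) (fun=> e0) (fun=> mE)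
  gb_ge0 (fun=> measurable_boxev _ _ _).
rewrite big_seq1; apply => w; rewrite big_seq1 indicE.
case: (boolP (w \in E)) => [|_]; last first.
  by rewrite mulr0 sumr_ge0// => b _; rewrite mulr_ge0.
rewrite inE mulr1 /E/= => YE.
apply: (le_trans _ (relabel_cover _)).
  by rewrite ler_expR lerN2 -/k; lra.
move=> s su; apply: le_lt_trans (_ : _ <= Y u w) _.
  by apply: (@ler_sum_seq1 R _ u (fun s => `|X s.1 w / D s.1|)).
by apply: lt_le_trans YE _; rewrite /k -natrM natr1.
Qed.

Let box_prob_le_sqrt u : V u <= V u `^ 2^-1.
Proof.
have [V0|Vn0] := eqVneq (V u) 0; first by rewrite V0 powR_ge0.
by apply: ger1_powR; rewrite ?box_prob_le1 ?andbT ?lt0r ?Vn0 ?box_prob_ge0//; lra.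
Qed.

Definition entropy_cst : R := 6 * expsum_bound R * expR 3.

(* Comparing the nodes of the tree with independent positions in the same
   coordinates: by log-concavity the midpoints carry at least the geometric mean
   of the masses, and for fixed positions they overlap at most [6 ^+ k] times. *)
Lemma entropy_bound (om : seq step -> 'I_n -> R) M k :
  (forall u i, 0 <= om u i) -> (forall u, \sum_i om u i <= 1) ->
  \sum_(u <- words (steps R n M) k) path_weight (fun v t => om v t.1) u * V u `^ 2^-1
    <= 2 * expR 1 * entropy_cst ^+ k.
Proof.
move=> om0 om1; set wom := path_weight _.
pose N := (2 * k).+1; pose e : R := expR (- (3 * k%:R + 1)) / 2.
have e0 : 0 < e by rewrite divr_gt0 ?expR_gt0.
have W0 u : 0 <= wom u by exact: path_weight_ge0.
suff H : e * \sum_(u <- words (steps R n M) k) wom u * V u `^ 2^-1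
    <= (6 * expsum_bound R) ^+ k.
  rewrite -(ler_pM2l e0); apply: le_trans H _.
  rewrite /entropy_cst [in leRHS]exprMn -expRM_natl.
  rewrite /e opprD expRD !expRN.
  have x0 := expR_gt0 (3 * k%:R : R); have y0 := expR_gt0 (1 : R).
  rewrite [k%:R * 3]mulrC le_eqVlt; apply/orP; left; apply/eqP; field.
  by rewrite !lt0r_neq0.
rewrite mulr_sumr.
(* [e] is replaced by the average over relabelled boxes. Their masses are at most 1, hence at most
   their square roots, which [box_prob_midway] can use. *)
apply: (@le_trans _ _ (\sum_(u <- words (steps R n M) k)
   \sum_(b <- words (rng R N) k) gb b * (wom u * V (midway u b)))).
  rewrite big_seq [leRHS]big_seq; apply: ler_sum => u /size_words uk.
  have := relabel_lower u; rewrite uk -/N -/e => le_e.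
  have c0 : 0 <= wom u * V u `^ 2^-1 by rewrite mulr_ge0 ?powR_ge0.
  apply: le_trans (ler_wpM2r c0 le_e) _.
  rewrite mulr_suml; apply: ler_sum => b _.
  rewrite -!mulrA ler_wpM2l// mulrCA ler_wpM2l// mulrC.
  apply: le_trans (box_prob_midway D hX u b).
  by rewrite ler_wpM2l ?powR_ge0.
(* Once the positions [b] are fixed, the overlap count bounds the sum over the whole generation. *)
rewrite exchange_big/=.
apply: (@le_trans _ _ (\sum_(b <- words (rng R N) k) gb b * 6 ^+ k)).
  rewrite big_seq [leRHS]big_seq; apply: ler_sum => b /size_words bk.
  by rewrite -mulr_sumr ler_wpM2l//; exact: overlap_Pr.
by rewrite -mulr_suml mulrC exprMn ler_wpM2l ?exprn_ge0// sum_gb.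
Qed.

End entropy_bound.

(** * Borell's tail bound for linear functionals *)

Section borell.
Context d (T : measurableType d) (R : realType) (P : probability T R) (n : nat).
Context (X : 'I_n -> {RV P >-> R}) (hX : log_concave X).
Context (t : 'rV[R]_n) (p s : R) (p1 : 1 <= p) (s0 : 0 < s).

Let f (x : 'rV[R]_n) : R := \sum_i t ord0 i * x ord0 i.
Let Z (w : T) : R := \sum_i t ord0 i * X i w.
Context (Zs : (\int[P]_w (`|Z w| `^ p)%:E <= (s `^ p)%:E)%E).

Let fZ w : f (random_row X w) = Z w.
Proof. by apply: eq_bigr => i _; rewrite mxE. Qed.

Let f_continuous : continuous f.
Proof.
move=> x; apply: (cvg_big add_continuous) => [|i _].
  exact: nbhs_filter.
apply: (@continuousM R 'rV[R]_n (fun=> t ord0 i) (fun x => x ord0 i) x).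
  exact: cst_continuous.
exact: coord_continuous.
Qed.

Let closed_f_itv (I : set R) : closed I -> closed (f @^-1` I).
Proof. by move=> cI; apply: closed_comp => // x _; exact: f_continuous. Qed.

Let mZ : measurable_fun setT Z.
Proof. by apply: measurable_sum => i; apply: measurable_funM. Qed.

Let mZp : measurable_fun setT (fun w => Num.max 0 (Z w)).
Proof. by apply: measurable_maxr. Qed.

Let mZge (a : R) : measurable [set w | a <= Z w].
Proof. exact: measurable_superlevel. Qed.

Let markov_Z : Pr P [set w | 4 * s <= `|Z w|] <= 4 `^ (- p).
Proof.
have p0 : 0 < p by exact: lt_le_trans p1.
have mY : measurable_fun setT (fun w => `|Z w| `^ p).
  by apply: (measurableT_comp (measurable_powR p)); exact: measurableT_comp.
have := Pr_markov mY (fun=> powR_ge0 _ _) (powR_ge0 (4 * s) p) Zs.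
have -> : [set w | (4 * s) `^ p <= `|Z w| `^ p] = [set w | 4 * s <= `|Z w|].
  apply/seteqP; split => w /=; last first.
    by move=> h; apply: ge0_ler_powR; rewrite ?nnegrE ?mulr_ge0 ?(ltW p0) ?(ltW s0).
  rewrite leNgt [X in _ -> is_true X]leNgt => /negP h; apply/negP => h'; apply: h.
  by apply: gt0_ltr_powR; rewrite ?nnegrE ?mulr_ge0 ?(ltW s0).
rewrite powRM ?(ltW s0)// powRN => h.
have sp : 0 < s `^ p by exact: powR_gt0.
rewrite -[leRHS]mul1r ler_pdivlMr ?powR_gt0// -(ler_pM2r sp) mul1r.
by apply: le_trans h; rewrite le_eqVlt; apply/orP; left; apply/eqP; ring.
Qed.

(** The central set |Z| <= 4 s has mass at least 1/2, and mixing it with a far half-space lands in Z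
    >= 4 s, whose mass is at most 4^(-p) by Markov. Log-concavity then bounds the half-space, with a
    decay rate proportional to [p]. *)
Lemma borell_tail (j : nat) : Pr P [set w | j%:R * (4 * s) <= Z w] <= 2 `^ (- (p * j%:R / 2)).
Proof.
have p1' := p1; have s0' := s0.
have mabs : measurable [set w | 4 * s <= `|Z w|].
  by apply: measurable_superlevel; exact: measurableT_comp.
have four : 4 `^ (- p) = 2 `^ (- (p * 2)) :> R.
  have e4 : 4 = 2 `^ 2%:R :> R by rewrite powR_mulrn//; ring.
  by rewrite e4 -powRrM mulrN (mulrC p).
have C4 : Pr P [set w | 4 * s <= Z w] <= 4 `^ (- p).
  apply: le_trans markov_Z; apply: le_Pr => // w /= h.
  by apply: le_trans h _; exact: ler_norm.
case: j => [|[|j]].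
- by rewrite mulr0 mul0r oppr0 powRr0 Pr_le1.
- rewrite mul1r mulr1; apply: le_trans C4 _.
  by rewrite four ler_powR ?ler1n// lerN2; lra.
have j1 : 0 < j.+3%:R :> R by [].
have j1' : j.+3%:R = j%:R + 3 :> R by rewrite -addn3 natrD.
have j2' : j.+2%:R = j%:R + 2 :> R by rewrite -addn2 natrD.
have jge : 0 <= j%:R :> R by [].
(* The level is now [j.+2], and this [l] solves l (j + 2) - (1 - l) = 1, so mixtures just reach 4
   s. *)
pose l : R := 2 / j.+3%:R.
have l0 : 0 < l by rewrite divr_gt0.
have l1 : l < 1 by rewrite ltr_pdivrMr// mul1r j1'; lra.
have lj : l * j.+3%:R = 2 by rewrite divfK// lt0r_neq0.
have l01 : 0 < l < 1 by rewrite l0.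
pose K := f @^-1` `[j.+2%:R * (4 * s), +oo[%classic.
pose L := f @^-1` `[- (4 * s), 4 * s]%classic.
pose C := f @^-1` `[4 * s, +oo[%classic.
have cK : closed K by apply: closed_f_itv; exact: rray_closed.
have cL : closed L by apply: closed_f_itv; exact: itv_closed.
have cC : closed C by apply: closed_f_itv; exact: rray_closed.
have := log_concave_closed hX l01 cK cL (measurable_random_row_closed X cC).
have -> : random_row X @^-1` K = [set w | j.+2%:R * (4 * s) <= Z w].
  by apply/seteqP; split => w /=; rewrite /K /= in_itv/= andbT fZ.
have -> : random_row X @^-1` C = [set w | 4 * s <= Z w].
  by apply/seteqP; split => w /=; rewrite /C /= in_itv/= andbT fZ.
have fD x y (a b : R) : f (a *: x + b *: y) = a * f x + b * f y.
  rewrite /f !mulr_sumr -big_split; apply: eq_bigr => i _.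
  by rewrite !mxE/=; ring.
have KLC x y : K x -> L y -> C (l *: x + (1 - l) *: y).
  rewrite /K /L /C /= !in_itv/= !andbT fD => fx /andP[fy _].
  have := ler_wpM2l (ltW l0) fx.
  have l1' : 0 <= 1 - l by lra.
  have := ler_wpM2l l1' fy.
  have -> : l * (j.+2%:R * (4 * s)) = (2 - l) * (4 * s).
    by rewrite -lj j1' j2'; ring.
  by move=> h1 h2; lra.
move=> /(_ KLC) H.
have PL : 2^-1 <= Pr P (random_row X @^-1` L).
  apply: (@le_trans _ _ (Pr P (~` [set w | 4 * s <= `|Z w|]))).
    rewrite Pr_setC// lerBrDr -lerBrDl.
    apply: le_trans markov_Z _.
    rewrite (_ : 1 - _ = 2 `^ (-1)); last by rewrite powR_inv1//; lra.
    by rewrite four ler_powR ?ler1n//; lra.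
  apply: le_Pr => //; first exact: measurableC.
    exact: measurable_random_row_closed.
  move=> w /= /negP; rewrite -ltNge /L /= in_itv/= fZ ltr_norml => /andP[a b].
  by rewrite !ltW.
set q := Pr P [set w | _ <= Z w] in H *.
have q0 : 0 <= q by exact: Pr_ge0.
(* The factor 2 lost to the central set is absorbed because [p] is at least 1. *)
have ql : q `^ l <= 2 `^ (- p).
  have h1 : q `^ l * 2^-1 <= 2 `^ (- (p * 2)).
    rewrite -four; apply: le_trans C4; apply: le_trans H.
    rewrite ler_wpM2l ?powR_ge0//.
    apply: le_trans (_ : _ <= 2^-1 `^ (1 - l)) _.
      by apply: ger1_powR; lra.
    apply: ge0_ler_powR; rewrite ?nnegrE ?invr_ge0 ?Pr_ge0//; lra.
  have : q `^ l <= 2 `^ (- (p * 2)) * 2 `^ 1.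
    by rewrite powRr1// -ler_pdivrMr.
  move=> /le_trans; apply; rewrite -powRD ?pnatr_eq0 ?implybT//.
  by rewrite ler_powR ?ler1n//; lra.
have lV : 0 <= l^-1 by rewrite invr_ge0 ltW.
have := ge0_ler_powR lV _ _ ql.
rewrite !nnegrE !powR_ge0 => /(_ isT isT).
rewrite -!powRrM divff ?lt0r_neq0// powRr1// => /le_trans; apply.
rewrite ler_powR ?ler1n//.
rewrite /l invf_div mulNr lerN2 j1' j2'; lra.
Qed.

Let rho : R := 2 `^ (- 8^-1).

Let rho01 : 0 <= rho < 1.
Proof.
rewrite powR_ge0/= /rho powRN invf_lt1 ?powR_gt0//.
rewrite -[ltLHS](powRr0 (2 : R)) /powR pnatr_eq0/= ltr_expR ltr_pM2r ?invr_gt0//.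
by rewrite ln_gt0// ltr1n.
Qed.

Let sum_indic_ge (x : R) (N : nat) : x < N%:R ->
  x <= \sum_(j < N) ((j%:R <= x)%R%:R : R).
Proof.
elim: N x => [|N IH] x xN; first by rewrite big_ord0 ltW.
rewrite big_ord_recr/=.
have [h|h] := leP N%:R x; last by rewrite addr0; exact: IH.
rewrite (eq_bigr (fun=> 1)).
  by rewrite sumr_const card_ord natr1 ltW.
by move=> j _; rewrite (le_trans _ h)// ler_nat ltnW.
Qed.

Definition borell_cst : R := 4 / (1 - 2 `^ (- 8^-1)).

(** Slice Z into layers of height 4 s. Within [A], a layer has mass at most a^(1 - eta) times the
    tail to the power eta; for eta = 1/(4p) the [p] of the tail cancels and the layers decay like
    2^(-j/8), the ratio in [borell_cst]. *)
Lemma borell_integral (A : set T) : measurable A ->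
  (\int[P]_(w in A) (Num.max 0 (Z w))%:E <=
   (borell_cst * s * Pr P A `^ (1 - (4 * p)^-1))%:E)%E.
Proof.
move=> mA; have p1' := p1; have s0' := s0; set a := Pr P A; set eta := (4 * p)^-1.
have eta0 : 0 < eta by rewrite invr_gt0; lra.
have eta1 : eta <= 1 by rewrite invf_le1; lra.
pose B N := [set w | Z w < N%:R * (4 * s)].
have mB N : measurable (B N) by exact: measurable_strict_sublevel mZ _.
have s4 : 0 < 4 * s by lra.
apply: (@integral_le_exhaustion _ _ _ _ _ B) => //.
- move=> M N MN w /= h; apply: lt_le_trans h _.
  by rewrite ler_wpM2r ?ler_nat// ltW.
- move=> w; exists (Num.truncn (Z w / (4 * s))).+1.
  by rewrite /B /= -ltr_pdivrMr//; exact: truncnS_gt.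
- by move=> w; rewrite le_max lexx.
move=> N.
pose E (j : 'I_N) := A `&` [set w | j%:R * (4 * s) <= Z w].
have mE j : measurable (E j) by apply: measurableI.
apply: le_trans (_ : _ <= (\sum_(j < N) (4 * s) * Pr P (E j))%:E)%E _.
  apply: integral_le_step => //.
  - by move=> j; exact: ltW.
  - exact: measurableI.
  - by move=> w; rewrite le_max lexx.
  move=> w [Aw Bw]; rewrite -mulr_sumr ge_max; apply/andP; split.
    by rewrite mulr_ge0 ?(ltW s4)// sumr_ge0.
  rewrite -ler_pdivrMl// mulrC.
  apply: le_trans (sum_indic_ge (_ : _ < N%:R)) _; first by rewrite ltr_pdivrMr.
  apply: ler_sum => j _; rewrite ler_pdivlMr// indicE.
  by case: (boolP (j%:R * (4 * s) <= Z w)) => // h; rewrite mem_set.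
rewrite lee_fin.
have a0 : 0 <= a by exact: Pr_ge0.
have term j : Pr P (E j) <= a `^ (1 - eta) * rho ^+ j.
  have h1 : Pr P (E j) <= a by apply: le_Pr => // w [].
  have h2 : Pr P (E j) <= 2 `^ (- (p * j%:R / 2)).
    by apply: le_trans (borell_tail j); apply: le_Pr => // w [].
  have e0 : 0 <= Pr P (E j) by exact: Pr_ge0.
  rewrite -[leLHS]powRr1//.
  have -> : Pr P (E j) `^ 1 = Pr P (E j) `^ (1 - eta) * Pr P (E j) `^ eta.
    by rewrite -powRD ?subrK// oner_eq0.
  apply: ler_pM; rewrite ?powR_ge0//.
    by apply: ge0_ler_powR; rewrite ?nnegrE ?subr_ge0.
  have -> : rho ^+ j = (2 `^ (- (p * j%:R / 2))) `^ eta.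
    rewrite -powR_mulrn ?powR_ge0// /rho -!powRrM /eta; congr (_ `^ _); field.
    by rewrite gt_eqF//; lra.
  by apply: ge0_ler_powR; rewrite ?nnegrE ?powR_ge0// ltW.
rewrite -mulr_sumr; apply: le_trans (_ : _ <= 4 * s * (a `^ (1 - eta) * (1 - rho)^-1)) _.
  rewrite ler_pM2l//; apply: le_trans (ler_sum _ (fun j _ => term j)) _.
  by rewrite -mulr_sumr ler_wpM2l ?powR_ge0// sum_geom_le.
by rewrite /borell_cst -/rho le_eqVlt; apply/orP; left; apply/eqP; ring.
Qed.

End borell.

(** * Deviations and centre of a concentrated box *)

Section node.
Context d (T : measurableType d) (R : realType) (P : probability T R) (n : nat).
Context (X : 'I_n -> {RV P >-> R}) (D : 'I_n -> R).
Context (hX : log_concave X) (D0 : forall i, 0 < D i).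
Local Notation step := ('I_n * R)%type.
Local Notation V := (box_prob X D).
Local Notation boxev := (boxev X D).

Definition mean_cst (k : R) : R := 6 / (1 - expR (- k)) ^+ 2.

Let mW i (c : R) : measurable_fun setT (fun w => `|X i w / D i - c|).
Proof.
apply: measurableT_comp => //; apply: measurable_funB => //.
exact: measurable_funM.
Qed.

Lemma node_mean u i (c0 k : R) : 0 < k ->
  (forall c, V ((i, c) :: u) <= 2 * V u * expR (- (k * `|c - c0|))) ->
  (\int[P]_(w in boxev u) (`|X i w / D i - c0|)%:E <= (mean_cst k * V u)%:E)%E.
Proof.
move=> k0 tail.
pose B (N : nat) := [set w | `|X i w / D i - c0| < N%:R].
have mB N : measurable (B N) by exact: measurable_strict_sublevel (mW i c0) _.
apply: (@integral_le_exhaustion _ _ _ _ _ B) => //.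
- exact: measurable_boxev.
- by move=> M N MN w /= h; apply: lt_le_trans h _; rewrite ler_nat.
- move=> w; exists (Num.truncn `|X i w / D i - c0|).+1.
  exact: truncnS_gt.
move=> N; apply: le_trans (_ : _ <= (\sum_(c <- rng R N) (`|c| + 1) * V ((i, c0 + c) :: u))%:E)%E _.
  apply: integral_le_step => //.
  - by move=> c; exact: measurable_boxev.
  - by apply: measurableI => //; exact: measurable_boxev.
  move=> w [uw /rng_cover[c cN /andP[h1 h2]]].
  have F0 c' : 0 <= (`|c'| + 1) * \1_(boxev ((i, c0 + c') :: u)) w :> R.
    by rewrite mulr_ge0// addr_ge0.
  apply: le_trans (ler_sum_seq1 F0 cN).
  rewrite indicE mem_set ?mulr1; last first.
    by apply/(boxev_cons X D0); split=> //; apply/andP; split; lra.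
  have := ler_norm c; have := ler_norm (- c); rewrite normrN => h3 h4.
  by rewrite ler_norml; apply/andP; split; lra.
rewrite lee_fin.
pose rho := expR (- k).
have rho01 : 0 <= rho < 1 by rewrite expR_ge0 expR_lt1 oppr_lt0.
have V0 : 0 <= V u by exact: box_prob_ge0.
have ek j : expR (- (k * j%:R)) = rho ^+ j by rewrite -mulNr mulrC expRM_natl.
have e0 j : 0 <= rho ^+ j by rewrite exprn_ge0// expR_ge0.
have S1 := sum_arith_geom_le N rho01.
(* The cells at c0 + j and c0 - j - 1 have deviation at most j + 1 and j + 2 and mass at most 2
   rho^j [V u]; together they give 4 j + 6 <= 6 (j + 1). *)
apply: le_trans (_ : _ <= \sum_(j < N) 6 * V u * (j.+1%:R * rho ^+ j)) _; last first.
  by rewrite -mulr_sumr /mean_cst -/rho [leRHS]mulrAC ler_wpM2l// mulr_ge0.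
rewrite big_rng -big_split/=; apply: ler_sum => j _.
have T1 := tail (c0 + j%:R); have T2 := tail (c0 + - j.+1%:R).
have j0 : 0 <= j%:R :> R by [].
move: T1 T2; rewrite ![c0 + _]addrC !addrK normrN !ger0_norm// !ek exprS => T1 T2.
have r1 : rho <= 1 by case/andP: rho01 => _ /ltW.
have T3 : V ((i, - j.+1%:R + c0) :: u) <= 2 * V u * rho ^+ j.
  apply: le_trans T2 _; rewrite ler_wpM2l ?mulr_ge0//.
  by rewrite ler_piMl.
have jp : 0 <= j%:R + 1 :> R by rewrite addr_ge0.
have jpp : 0 <= j.+1%:R + 1 :> R by rewrite addr_ge0.
have := ler_wpM2l jp T1; have := ler_wpM2l jpp T3.
have : 0 <= V u * rho ^+ j by rewrite mulr_ge0.
have : 0 <= j%:R * (V u * rho ^+ j) by rewrite mulr_ge0// mulr_ge0.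
rewrite -natr1; nra.
Qed.

(** Pointwise, the norm of the centre is at most the positive part of Z plus the sum of |t_i| D_i
    |X_i / D_i - m_i|. Integrate over the box and divide by its mass: [borell_integral] bounds the
    first part, [node_mean] the second. *)
Lemma node_center u (m : 'I_n -> R) (k r p s : R) :
  1 <= r -> 1 <= p -> 0 < s -> 0 < k -> 0 < V u ->
  (forall t : 'rV[R]_n, lnorm (hoelder_conjugate r%:E) t <= 1 ->
    (\int[P]_w (`|\sum_(i < n) t ord0 i * X i w| `^ p)%:E <= (s `^ p)%:E)%E) ->
  (forall i c, V ((i, c) :: u) <= 2 * V u * expR (- (k * `|c - m i|))) ->
  pnorm r (fun i => D i * m i) <=
    borell_cst R * s * V u `^ (- (4 * p)^-1) + 2 * mean_cst k * pnorm r D.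
Proof.
move=> r1 p1 s0 k0 Vu weak tail.
have [t [t1 tm ty]] := norming_vector (fun i => D i * m i) r1.
have BI := borell_integral hX p1 s0 (weak t t1) (measurable_boxev X D u).
have mA := measurable_boxev X D u.
pose Z w := Num.max 0 (\sum_(i < n) t ord0 i * X i w).
pose Q i w := (`|X i w / D i - m i|)%:E.
set g := pnorm _ _.
have mZ : measurable_fun setT Z.
  by apply: measurable_maxr => //; apply: measurable_sum => i; exact: measurable_funM.
have mQ i : measurable_fun (boxev u) (Q i).
  by apply/measurable_EFinP; apply: measurable_funTS; exact: mW.
have Q0 i w : (0 <= Q i w)%E by rewrite lee_fin.
have tD0 i : 0 <= `|t ord0 i| * D i by rewrite mulr_ge0// ltW.
have mS : measurable_fun (boxev u) (fun w => (\sum_i (`|t ord0 i| * D i)%:E * Q i w)%E).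
  by apply: emeasurable_sum => i; exact: measurable_funeM.
have main : (g%:E * (V u)%:E <=
   (borell_cst R * s * V u `^ (1 - (4 * p)^-1))%:E + (mean_cst k * V u * (2 * pnorm r D))%:E)%E.
  apply: (@le_trans _ _ (\int[P]_(w in boxev u)
    ((Z w)%:E + (\sum_i (`|t ord0 i| * D i)%:E * Q i w)))%E).
    rewrite /box_prob -EFin_Pr// -integral_cst//; apply: ge0_le_integral => //.
    - by move=> w _; rewrite lee_fin pnorm_ge0.
    - by apply: emeasurable_funD => //; apply/measurable_EFinP; exact: measurable_funTS.
    move=> w _; rewrite /g -tm /Q.
    have -> : (\sum_i (`|t ord0 i| * D i)%:E * `|X i w / D i - m i|%:E)%E =
        (\sum_i `|t ord0 i| * D i * `|X i w / D i - m i|)%:E.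
      by rewrite -sumEFin; apply: eq_bigr => i _; rewrite EFinM.
    rewrite -EFinD lee_fin.
    apply: le_trans (_ : _ <= \sum_(i < n) t ord0 i * X i w +
      \sum_(i < n) `|t ord0 i| * D i * `|X i w / D i - m i|) _; last first.
      by rewrite lerD2r le_max lexx orbT.
    rewrite -big_split; apply: ler_sum => i _ /=.
    rewrite -lerBlDl.
    have -> : t ord0 i * (D i * m i) - t ord0 i * X i w = - (t ord0 i * D i * (X i w / D i - m i)).
      by field; rewrite lt0r_neq0.
    apply: le_trans (ler_norm _) _.
    by rewrite normrN !normrM (gtr0_norm (D0 i)).
  have Z0 w : (0 <= (Z w)%:E)%E by rewrite lee_fin le_max lexx.
  have mZe : measurable_fun (boxev u) (fun w => (Z w)%:E).
    by apply/measurable_EFinP; exact: measurable_funTS.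
  have q0 i w : (0 <= (`|t ord0 i| * D i)%:E * Q i w)%E by rewrite mule_ge0// lee_fin.
  have mq i : measurable_fun (boxev u) (fun w => (`|t ord0 i| * D i)%:E * Q i w)%E.
    exact: measurable_funeM.
  rewrite ge0_integralD//; last by move=> w _; exact: sume_ge0.
  apply: leeD => //; rewrite ge0_integral_sum//.
  apply: le_trans (_ : _ <= \sum_i (`|t ord0 i| * D i)%:E * (mean_cst k * V u)%:E)%E _.
    apply: lee_sum => i _; rewrite ge0_integralZl_EFin//.
    by apply: lee_wpmul2l; rewrite ?lee_fin// node_mean.
  under eq_bigr do rewrite -EFinM; rewrite sumEFin lee_fin -mulr_suml mulrC.
  rewrite ler_wpM2l//.
    by rewrite mulr_ge0 ?box_prob_ge0// /mean_cst divr_ge0// sqr_ge0.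
  by apply: le_trans (ty D); apply: ler_sum => i _; rewrite (gtr0_norm (D0 i)).
move: main; rewrite -EFinM -EFinD lee_fin -ler_pdivlMr//.
move=> /le_trans; apply; rewrite mulrDl; apply: lerD.
  have -> : V u `^ (1 - (4 * p)^-1) = V u * V u `^ (- (4 * p)^-1).
    by rewrite powRD ?(gt_eqF Vu) ?implybT// powRr1// ltW.
  by rewrite le_eqVlt; apply/orP; left; apply/eqP; field; rewrite gt_eqF.
by rewrite le_eqVlt; apply/orP; left; apply/eqP; field; rewrite gt_eqF.
Qed.
End node.

(** * One generation of the tree *)

Section tree.
Context d (T : measurableType d) (R : realType) (P : probability T R) (n : nat).
Context (X : 'I_n -> {RV P >-> R}) (D : 'I_n -> R) (r p s : R).
Context (hX : log_concave X) (D0 : forall i, 0 < D i) (n0 : (0 < n)%N).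
Context (r1 : 1 <= r) (p1 : 1 <= p) (s0 : 0 < s).
Context (weak : forall t : 'rV[R]_n, lnorm (hoelder_conjugate r%:E) t <= 1 ->
  (\int[P]_w (`|\sum_(i < n) t ord0 i * X i w| `^ p)%:E <= (s `^ p)%:E)%E).
(* [k] and [K] are the constants provided by [slab_tail] and [powR_expR_le]. *)
Context (theta k K : R) (theta0 : 0 < theta) (k0 : 0 < k) (K1 : 1 <= K).
Context (tail : forall (v : R -> R) (a c0 : R), 0 < a -> (forall c, 0 <= v c <= a) ->
  (forall l c c' : R, 0 < l < 1 ->
     v c `^ l * v c' `^ (1 - l) <= v (l * c + (1 - l) * c')) ->
  (forall N (delta : R), 2 <= `|delta| -> \sum_(j < N) v (c0 + j%:R * delta) <= a) ->
  theta ^+ 4 * a <= v c0 ->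
  forall c, v c <= 2 * a * expR (- (k * `|c - c0|))).
Context (HK : forall r y : R, 1 <= r -> 1 <= y ->
  y `^ r * expR (- (k / 4 * (K * r * y))) <= theta / (2 * expR (k / 4))).

Local Notation step := ('I_n * R)%type.
Local Notation V := (box_prob X D).
Local Notation boxev := (boxev X D).
Local Notation steps M := (steps R n M).
Let dn := pnorm r D.

(** The outer 2 comes from the quasi-triangle inequality, the first two terms from [node_center],
    and [2 * K] from the stopping radius 2 K r |D|_r. *)
Definition stop_cst : R := 2 * (borell_cst R + 2 * mean_cst k + 2 * K).
Definition stop_bound : R := (stop_cst * r * (s + dn)) `^ p.
Definition norm_moment (w : T) : R := pnorm r (fun i => X i w) `^ p.
Definition bounded_ev (M : nat) : set T := [set w | forall i, `|X i w / D i| < M%:R].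
(** A crude bound that depends on [M]; it multiplies only null boxes and a remainder that vanishes
    with the depth. *)
Definition moment_max (M : nat) : R := pnorm r (fun i => M%:R * D i) `^ p.

Let r0 : 0 < r. Proof. exact: lt_le_trans r1. Qed.
Let p0 : 0 < p. Proof. exact: lt_le_trans p1. Qed.

Let dn0 : 0 < dn.
Proof.
apply: lt_le_trans (ler_coord_pnorm D (Ordinal n0) r0).
by rewrite normr_gt0 gt_eqF.
Qed.

Lemma norm_moment_le M w : bounded_ev M w -> norm_moment w <= moment_max M.
Proof.
move=> Bw; rewrite /norm_moment /moment_max.
apply: (ler_powR_base (ltW p0) (pnorm_ge0 _ _)).
apply: (ler_pnorm r0) => i; rewrite normrM normr_nat.
by have := ltW (Bw i); rewrite normrM normfV ler_pdivrMr// normr_gt0 gt_eqF.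
Qed.

Let cover M i w : bounded_ev M w -> exists2 c, c \in rng R M & c <= X i w / D i <= c + 1.
Proof. by move=> Bw; exact: rng_cover. Qed.

Let Kr0 : 0 < K * r.
Proof. by rewrite mulr_gt0// (lt_le_trans _ K1). Qed.

(* At the node [u], the part of the [p]-th moment that does not stop, stopping
   being paid for by [v], is distributed over the children [t :: u] with weights
   [q t]; the last clause is the gain of a small factor [theta] per generation. *)
Definition node_step (M : nat) (u : seq step) (v : R) (q : step -> R) (om : 'I_n -> R) :=
  [/\ 0 <= v, (forall t, 0 <= q t), (forall i, 0 <= om i), \sum_i om i <= 1 &
  [/\ forall w, bounded_ev M w -> norm_moment w * \1_(boxev u) w <=
        v * \1_(boxev u) w +
        \sum_(t <- steps M) q t * (norm_moment w * \1_(boxev (t :: u)) w),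
      v * V u <= stop_bound * V u `^ (3 / 4) &
      forall t, t \in steps M -> q t * V (t :: u) `^ (1 / 4) <= theta * om t.1 * V u `^ (1 / 4)]].

Let pone (x : R) : 1 `^ x = 1 :> R. Proof. by rewrite powR1. Qed.

Let mean_cst_ge0 : 0 <= mean_cst k.
Proof. by rewrite /mean_cst divr_ge0// sqr_ge0. Qed.

Let borell_cst_ge0 : 0 <= borell_cst R.
Proof.
rewrite /borell_cst divr_ge0// subr_ge0 powRN invf_le1 ?powR_gt0//.
by rewrite -[leLHS](powRr0 (2 : R)) ler_powR ?ler1n// invr_ge0.
Qed.

Let K0 : 0 <= K. Proof. exact: le_trans K1. Qed.

Lemma stop_cst_ge0 : 0 <= stop_cst.
Proof.
rewrite /stop_cst; have := K0; have := mean_cst_ge0; have := borell_cst_ge0; lra.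
Qed.

Let stop_arith (b e : R) : 0 < e -> 1 <= b ->
  2 * (borell_cst R * s * b + 2 * mean_cst k * e + 2 * (K * r * e)) <=
  stop_cst * r * (s + e) * b.
Proof.
rewrite /stop_cst; have := K0; have := mean_cst_ge0; have := borell_cst_ge0.
move: (borell_cst R) (mean_cst k) r1 s0 => x y r1' s0' x0 y0 k00 e0 b1.
have se : 0 < s + e by lra.
have rb : 1 <= r * b by rewrite -[leLHS]mulr1 ler_pM.
have rs : s * b <= r * (s + e) * b.
  rewrite ler_wpM2r//; first by lra.
  by rewrite -[leLHS]mul1r ler_pM//; lra.
have rd : e <= r * (s + e) * b.
  by rewrite mulrAC -[leLHS]mul1r ler_pM//; lra.
have rrd : r * e <= r * (s + e) * b.
  rewrite -[leLHS]mulr1 ler_pM ?mulr_ge0//; try lra.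
  by rewrite ler_wpM2l//; lra.
have := ler_wpM2l x0 rs; have := ler_wpM2l y0 rd; have := ler_wpM2l k00 rrd.
rewrite !mulrA; lra.
Qed.

Let F0 w : 0 <= norm_moment w. Proof. exact: powR_ge0. Qed.

Let indic0 (A : set T) w : 0 <= \1_A w :> R. Proof. by []. Qed.

Let node_null M u : V u = 0 -> exists v q om, node_step M u v q om.
Proof.
move=> Vu0; exists (moment_max M), (fun=> 0), (fun=> 0); split => //.
- exact: powR_ge0.
- by rewrite big1.
split.
- move=> w Bw; rewrite big1 ?addr0; last by move=> t _; rewrite mul0r.
  by apply: ler_wpM2r; [exact: indic0|exact: norm_moment_le].
- by rewrite Vu0 mulr0 mulr_ge0// powR_ge0.
- by move=> t _; rewrite mulr0 !mul0r.
Qed.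

(** All the weight goes to the coordinate [i]. The gain [theta] is the power 1/4 of the mass ratio,
    hence the threshold [theta ^+ 4]. *)
Let node_spread M u i : (forall c, c \in rng R M -> V ((i, c) :: u) <= theta ^+ 4 * V u) ->
  exists v q om, node_step M u v q om.
Proof.
move=> Hi; exists 0, (fun t => (t.1 == i)%:R), (fun j => (j == i)%:R); split => //.
- by rewrite (bigD1 i)//= eqxx big1 ?addr0// => j /negbTE ->.
split.
- move=> w Bw; rewrite mul0r add0r big_steps (bigD1 i)//=.
  apply: le_trans (_ : _ <= \sum_(c <- rng R M)
     (i == i)%:R * (norm_moment w * \1_(boxev ((i, c) :: u)) w)) _; last first.
    by rewrite lerDl sumr_ge0// => j _; rewrite sumr_ge0// => c _; rewrite !mulr_ge0.
  have [c cM cx] := cover i Bw.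
  have G0 c' : 0 <= (i == i)%:R * (norm_moment w * \1_(boxev ((i, c') :: u)) w) :> R.
    by rewrite !mulr_ge0.
  apply: le_trans (ler_sum_seq1 G0 cM).
  rewrite eqxx mul1r ler_wpM2l// !indicE ler_nat.
  case: (boolP (w \in boxev u)) => //; rewrite inE => uw.
  by rewrite mem_set//; apply/(boxev_cons X D0).
- by rewrite mul0r mulr_ge0// powR_ge0.
- move=> [j c] /allpairsP[[j' c'] /= [_ cM [-> ->]]].
  case: eqP => [->|_]; last by rewrite mulr0 !mul0r.
  rewrite [_%:R * _]mul1r [theta * _]mulr1.
  have -> : theta = (theta ^+ 4) `^ (1 / 4).
    rewrite -powR_mulrn ?(ltW theta0)// -powRrM (_ : 4%:R * _ = 1) ?powRr1 ?(ltW theta0)//.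
    by field.
  have e0 : 0 <= theta ^+ 4 by rewrite exprn_ge0// ltW.
  rewrite -(powRM _ e0 (box_prob_ge0 X D u)).
  by apply: ler_powR_base; rewrite ?box_prob_ge0 ?divr_ge0// Hi.
Qed.

Section concentrated.
Context (M : nat) (u : seq step) (Vu : 0 < V u) (m : 'I_n -> R).
Context (Hm : forall i, theta ^+ 4 * V u <= V ((i, m i) :: u)).

Let tailu i c : V ((i, c) :: u) <= 2 * V u * expR (- (k * `|c - m i|)).
Proof.
apply: (tail (v := fun c => V ((i, c) :: u)) Vu) => //.
- by move=> c'; rewrite box_prob_ge0 box_prob_cons_le.
- by move=> l c1 c2 l01; exact: box_prob_conv.
- by move=> N delta; exact: box_prob_disjoint.
Qed.

Let q (t : step) : R := (D t.1 / dn) `^ r *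
  (if K * r < `|t.2 - m t.1| + 1 then ((`|t.2 - m t.1| + 1) / (K * r)) `^ r else 0).

Let q0 t : 0 <= q t.
Proof. by rewrite mulr_ge0 ?powR_ge0//; case: ifP => // _; rewrite powR_ge0. Qed.

Let om (i : 'I_n) : R := (D i / dn) `^ r.

Let sum_om : \sum_i om i = 1.
Proof.
have dnr : 0 < dn `^ r by exact: powR_gt0.
have omE i : om i = `|D i| `^ r / dn `^ r.
  rewrite /om powRM ?invr_ge0 ?(ltW (D0 _)) ?(ltW dn0)// (gtr0_norm (D0 i)).
  by rewrite -(powR_inv1 (ltW dn0)) -powRrM mulN1r powRN.
under eq_bigr do rewrite omE.
by rewrite -mulr_suml -powR_pnorm// divff// gt_eqF.
Qed.

Let q_small t : q t * V (t :: u) `^ (1 / 4) <= theta * om t.1 * V u `^ (1 / 4).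
Proof.
case: t => i c; rewrite /q -/(om i) /=.
have om0 : 0 <= om i by exact: powR_ge0.
case: ifP => [h|_]; last by rewrite mulr0 mul0r !mulr_ge0 ?powR_ge0// ltW.
set z := `|c - m i| in h *; set y := (z + 1) / (K * r).
have y1 : 1 <= y by rewrite ler_pdivlMr// mul1r ltW.
(* The shift by 1 costs the factor exp (k / 4); together with the 2 from [tailu] it is paid for by
   the denominator in [HK]. *)
have zE : z = K * r * y - 1 by rewrite /y mulrC divfK ?addrK// gt_eqF.
rewrite -mulrA [theta * om i]mulrC -[leRHS]mulrA ler_wpM2l//.
have h4 : 0 <= 1 / 4 :> R by rewrite divr_ge0.
have T1 : V ((i, c) :: u) `^ (1 / 4) <= 2 * V u `^ (1 / 4) * expR (- (k / 4 * z)).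
  apply: le_trans (_ : _ <= (2 * V u * expR (- (k * z))) `^ (1 / 4)) _.
    by apply: (ler_powR_base h4 (box_prob_ge0 _ _ _)); exact: tailu.
  rewrite !powRM ?mulr_ge0 ?box_prob_ge0 ?expR_ge0//.
  rewrite -expRM (_ : - (k * z) * (1 / 4) = - (k / 4 * z)); last by field.
  rewrite ler_wpM2r ?expR_ge0// ler_wpM2r ?powR_ge0//.
  by apply: ler1_powR; lra.
apply: le_trans (ler_wpM2l (powR_ge0 _ _) T1) _.
have H := HK r1 y1.
have ek : expR (- (k / 4 * z)) = expR (k / 4) * expR (- (k / 4 * (K * r * y))).
  by rewrite -expRD zE; congr expR; ring.
have ep : 0 < 2 * expR (k / 4) by rewrite mulr_gt0// expR_gt0.
move: H; rewrite ler_pdivlMr// => H.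
have V4 : 0 <= V u `^ (1 / 4) by exact: powR_ge0.
apply: le_trans (_ : _ <= (y `^ r * expR (- (k / 4 * (K * r * y))) * (2 * expR (k / 4)))
  * V u `^ (1 / 4)) _.
  by rewrite ek le_eqVlt; apply/orP; left; apply/eqP; ring.
by rewrite ler_wpM2r.
Qed.

Let stop_le w : boxev u w ->
  \sum_i `|X i w - D i * m i| `^ r <= 2 * (K * r * dn) `^ r ->
  norm_moment w <= stop_bound * V u `^ (- (1 / 4)).
Proof.
move=> uw H; have p0' := p0; have dn0' := dn0; have s0' := s0.
have Krd0 : 0 < K * r * dn by rewrite mulr_gt0.
have C0 := node_center hX D0 r1 p1 s0 k0 Vu weak tailu.
have S1 : pnorm r (fun i => X i w - D i * m i) <= 2 * (K * r * dn).
  have b0 : 0 <= 2 * (K * r * dn) by rewrite mulr_ge0// ltW.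
  apply: (pnorm_le_powR r0 b0); apply: le_trans H _.
  rewrite [leRHS](powRM _ (ler0n _ 2) (ltW Krd0)) ler_wpM2r ?powR_ge0//.
  by apply: le1r_powR => //; rewrite ler1n.
have S2 := pnorm_quasi_triangle (fun i => D i * m i) (fun i => X i w - D i * m i) r1.
have eX : (fun i => D i * m i + (X i w - D i * m i)) = (fun i => X i w).
  by apply/funext => i; rewrite addrC subrK.
rewrite eX in S2.
set a := V u `^ (- (4 * p)^-1) in C0 *.
(* Hence [a] may multiply every term of the bound; its p-th power is [V u] to the power -1/4. *)
have a1 : 1 <= a.
  rewrite /a powRN invf_ge1 ?powR_gt0//.
  rewrite -[leRHS](pone (4 * p)^-1); apply: ler_powR_base; rewrite ?box_prob_ge0 ?box_prob_le1//.
  by rewrite invr_ge0 mulr_ge0// ltW.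
have st0 := stop_cst_ge0.
have S3 : pnorm r (fun i => X i w) <= stop_cst * r * (s + dn) * a.
  apply: le_trans S2 _.
  apply: le_trans (_ : _ <= 2 * (borell_cst R * s * a + 2 * mean_cst k * dn + 2 * (K * r * dn))) _.
    by rewrite ler_wpM2l// lerD.
  exact: stop_arith.
apply: le_trans (_ : _ <= (stop_cst * r * (s + dn) * a) `^ p) _.
  by apply: (ler_powR_base (ltW p0) (pnorm_ge0 _ _)).
have base0 : 0 <= stop_cst * r * (s + dn) :=
  mulr_ge0 (mulr_ge0 st0 (ltW r0)) (addr_ge0 (ltW s0) (ltW dn0)).
have a0 : 0 <= a by exact: le_trans a1.
rewrite (powRM p base0 a0).
rewrite /stop_bound /a -powRrM (_ : - (4 * p)^-1 * p = - (1 / 4))//.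
by field; rewrite gt_eqF.
Qed.

(** Divided by the r-th power of [K * r * dn], the sum exceeds 2. Subtracting [om i] from each term
    disposes of the slabs without weight and costs 1 in all, hence the factor 2 in the threshold. *)
Let unstopped w : bounded_ev M w -> boxev u w ->
  2 * (K * r * dn) `^ r < \sum_i `|X i w - D i * m i| `^ r ->
  1 <= \sum_(t <- steps M) q t * \1_(boxev (t :: u)) w.
Proof.
move=> Bw uw H.
have Krd0 : 0 < K * r * dn by rewrite mulr_gt0.
have term i : `|X i w - D i * m i| `^ r / (K * r * dn) `^ r - om i <=
    \sum_(c <- rng R M) q (i, c) * \1_(boxev ((i, c) :: u)) w.
  have [c cM cx] := cover i Bw.
  have G0 c' : 0 <= q (i, c') * \1_(boxev ((i, c') :: u)) w by rewrite mulr_ge0.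
  apply: le_trans (ler_sum_seq1 G0 cM).
  rewrite indicE mem_set ?mulr1; last by apply/(boxev_cons X D0).
  pose z := `|X i w / D i - m i|.
  have zc : z <= `|c - m i| + 1.
    have -> : z = `|(c - m i) + (X i w / D i - c)| by congr `| _ |; ring.
    apply: le_trans (ler_normD _ _) _; rewrite lerD2l ler_norml.
    by case/andP: cx => h1 h2; apply/andP; split; lra.
  have -> : `|X i w - D i * m i| `^ r / (K * r * dn) `^ r = om i * (z / (K * r)) `^ r.
    rewrite /om -powRM ?divr_ge0 ?(ltW (D0 i)) ?(ltW dn0) ?(ltW Kr0)// ?normr_ge0//.
    rewrite -(mul1r ((K * r * dn) `^ r)^-1) mul1r.
    have -> : ((K * r * dn) `^ r)^-1 = (K * r * dn)^-1 `^ r.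
      by rewrite -(powR_inv1 (ltW Krd0)) -powRrM mulN1r powRN.
    rewrite -powRM ?invr_ge0 ?(ltW Krd0)//; congr (_ `^ _).
    have -> : X i w - D i * m i = D i * (X i w / D i - m i).
      by field; rewrite gt_eqF.
    rewrite normrM (gtr0_norm (D0 i)) -/z; field.
    have Kp : 0 < K by exact: lt_le_trans K1.
    by rewrite !gt_eqF.
  have om0 : 0 <= om i by exact: powR_ge0.
  have z0 : 0 <= z / (K * r) := divr_ge0 (normr_ge0 _) (ltW Kr0).
  rewrite /q /= -/(om i); case: ifP => h.
    apply: le_trans (_ : _ <= om i * (z / (K * r)) `^ r) _; first by rewrite gerBl.
    rewrite ler_wpM2l//; apply: (ler_powR_base (ltW r0) z0).
    by rewrite ler_pM2r ?invr_gt0.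
  rewrite mulr0 subr_le0 ler_piMr//.
  rewrite -[leRHS](pone r); apply: (ler_powR_base (ltW r0) z0).
  by rewrite ler_pdivrMr// mul1r (le_trans zc)// leNgt h.
rewrite big_steps; apply: le_trans (ler_sum _ (fun i _ => term i)).
rewrite sumrB sum_om -mulr_suml lerBrDr.
by rewrite ler_pdivlMr ?powR_gt0// (_ : 1 + 1 = 2) ?ltW.
Qed.

Lemma node_concentrated : exists v q om, node_step M u v q om.
Proof.
have sb0 : 0 <= stop_bound by exact: powR_ge0.
exists (stop_bound * V u `^ (- (1 / 4))), q, om; split => //.
- by rewrite mulr_ge0 ?powR_ge0.
- by move=> i; exact: powR_ge0.
- by rewrite sum_om.
split => //; last first.
  have -> : V u `^ (3 / 4) = V u `^ (- (1 / 4)) * V u.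
    rewrite -[X in _ = _ * X](powRr1 (box_prob_ge0 X D u)) -powRD ?(gt_eqF Vu) ?implybT//.
    by congr (_ `^ _); field.
  by rewrite mulrA.
move=> w Bw.
have qF0 t A : 0 <= q t * (norm_moment w * \1_A w) :=
  mulr_ge0 (q0 t) (mulr_ge0 (F0 w) (indic0 A w)).
have [uw|nuw] := pselect (boxev u w); last first.
  by rewrite indicE memNset// !mulr0 add0r sumr_ge0// => t _; exact: qF0.
rewrite indicE mem_set// !mulr1.
have S0 : 0 <= \sum_(t <- steps M) q t * (norm_moment w * \1_(boxev (t :: u)) w).
  by rewrite sumr_ge0// => t _; exact: qF0.
have [H|H] := leP (\sum_i `|X i w - D i * m i| `^ r) (2 * (K * r * dn) `^ r).
  by apply: le_trans (stop_le uw H) _; rewrite lerDl.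
have := unstopped Bw uw H => H1.
apply: le_trans (_ : _ <= \sum_(t <- steps M) q t * (norm_moment w * \1_(boxev (t :: u)) w)) _.
  under eq_bigr do rewrite mulrCA.
  by rewrite -mulr_sumr -[leLHS]mulr1 ler_wpM2l.
by rewrite lerDr mulr_ge0 ?powR_ge0.
Qed.

End concentrated.

Lemma node_step_exists M u : exists v q om, node_step M u v q om.
Proof.
have [|Vn0] := eqVneq (V u) 0; first exact: node_null.
have Vu : 0 < V u by rewrite lt0r Vn0 box_prob_ge0.
have [[i Hi]|none] := pselect (exists i, forall c, c \in rng R M ->
    V ((i, c) :: u) <= theta ^+ 4 * V u); first exact: (node_spread Hi).
have H i : exists c, theta ^+ 4 * V u <= V ((i, c) :: u).
  apply: contrapT => h; apply: none; exists i => c _.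
  by rewrite leNgt; apply/negP => h'; apply: h; exists c; exact: ltW.
have [m Hm] := choice H.
exact: (node_concentrated M Vu Hm).
Qed.

End tree.

(** * Summation over the generations *)

Section iteration.
Context d (T : measurableType d) (R : realType) (P : probability T R) (n : nat).
Context (X : 'I_n -> {RV P >-> R}) (D : 'I_n -> R) (r p s theta k K : R).
Context (hX : log_concave X) (D0 : forall i, 0 < D i) (r1 : 1 <= r) (p1 : 1 <= p).
Context (EX : forall i, (\int[P]_w (`|X i w|%:E) <= (D i)%:E)%E).
Context (theta0 : 0 < theta) (theta_small : theta * entropy_cst R = 2^-1).
Local Notation step := ('I_n * R)%type.
Local Notation V := (box_prob X D).
Local Notation boxev := (boxev X D).
Local Notation steps M := (steps R n M).
Local Notation F := (norm_moment X r p).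
Local Notation SB := (stop_bound D r p s k K).
Context (M : nat) (v : seq step -> R) (q : seq step -> step -> R) (om : seq step -> 'I_n -> R).
Context (node : forall u, node_step X D r p s theta k K M u (v u) (q u) (om u)).

Local Notation weight := (path_weight q).
Local Notation wom := (path_weight (fun u t => om u t.1)).

Fixpoint nodes (m : nat) : seq (seq step) :=
  if m is m'.+1 then nodes m' ++ words (steps M) m' else [::].

Let v0 u : 0 <= v u. Proof. by case: (node u). Qed.
Let q0 u t : 0 <= q u t. Proof. by case: (node u). Qed.
Let om0 u i : 0 <= om u i. Proof. by case: (node u). Qed.
Let om1 u : \sum_i om u i <= 1. Proof. by case: (node u). Qed.
Let SB0 : 0 <= SB. Proof. exact: powR_ge0. Qed.

Let weight0 u : 0 <= weight u. Proof. exact: path_weight_ge0. Qed.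

Lemma expand m w : bounded_ev X D M w ->
  F w <= \sum_(u <- nodes m) weight u * v u * \1_(boxev u) w +
         \sum_(u <- words (steps M) m) weight u * (F w * \1_(boxev u) w).
Proof.
move=> Bw; elim: m => [|m IH].
  by rewrite big_nil big_seq1 add0r /= mul1r indicE mem_set ?mulr1.
apply: le_trans IH _; rewrite [nodes m.+1]/= big_cat/= -addrA lerD2l.
rewrite [X in _ <= _ + X]big_words -big_split; apply: ler_sum => u _ /=.
have [_ _ _ _ [H _ _]] := node u.
apply: le_trans (ler_wpM2l (weight0 u) (H w Bw)) _.
rewrite mulrDr mulrA lerD2l mulr_sumr; apply: ler_sum => t _.
by rewrite mulrCA mulrA.
Qed.

Let weight_small m u : u \in words (steps M) m ->
  weight u * V u `^ (1 / 4) <= theta ^+ m * wom u.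
Proof.
elim: m u => [|m IH] u /=.
  by rewrite inE => /eqP ->; rewrite box_prob_nil powR1 !mulr1.
move=> /allpairsP[[u' t] /= [u'm tS ->]] /=.
have [_ _ _ _ [_ _ /(_ t tS) H]] := node u'.
rewrite mulrAC; apply: le_trans (ler_wpM2r (weight0 u') H) _.
have -> : theta * om u' t.1 * V u' `^ (1 / 4) * weight u' =
    theta * om u' t.1 * (weight u' * V u' `^ (1 / 4)) by ring.
have t0 : 0 <= theta * om u' t.1 by rewrite mulr_ge0// ltW.
apply: le_trans (ler_wpM2l t0 (IH _ u'm)) _.
by rewrite exprS le_eqVlt; apply/orP; left; apply/eqP; ring.
Qed.

Let V34 u : V u `^ (3 / 4) = V u `^ (1 / 4) * V u `^ 2^-1.
Proof.
have [->|V0] := eqVneq (V u) 0.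
  by rewrite !powR0 ?mulr0// ?mulf_neq0 ?invr_eq0 ?pnatr_eq0 ?oner_eq0.
by rewrite -powRD ?V0 ?implybT//; congr (_ `^ _); field.
Qed.

(** The part 1/4 of the exponent turns the weights into theta^m times [wom]; the part 1/2 is the one
    in [entropy_bound]. The choice of [theta] makes the product of the two rates 1/2. *)
Lemma level_bound m :
  \sum_(u <- words (steps M) m) weight u * V u `^ (3 / 4) <= 2 * expR 1 / 2 ^+ m.
Proof.
apply: le_trans (_ : _ <= theta ^+ m * (2 * expR 1 * entropy_cst R ^+ m)) _; last first.
  rewrite mulrCA -exprMn theta_small exprVn.
  by [].
apply: le_trans (ler_wpM2l (exprn_ge0 m (ltW theta0)) (entropy_bound hX D0 EX M m om0 om1)).
rewrite mulr_sumr big_seq [leRHS]big_seq; apply: ler_sum => u um.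
rewrite V34 !mulrA ler_wpM2r ?powR_ge0//; exact: weight_small.
Qed.

Lemma nodes_bound m :
  \sum_(u <- nodes m) weight u * v u * V u <= SB * (4 * expR 1).
Proof.
(* The exact partial sum of the geometric series makes the induction work. *)
apply: le_trans (_ : _ <= SB * (4 * expR 1 * (1 - (2 ^+ m)^-1))) _; last first.
  have e0 : 0 <= 4 * expR 1 :> R by rewrite mulr_ge0// expR_ge0.
  by rewrite ler_wpM2l// ler_piMr// gerBl invr_ge0 exprn_ge0.
elim: m => [|m IH]; first by rewrite big_nil expr0 invr1 subrr !mulr0.
rewrite [nodes m.+1]/= big_cat/=.
have H : \sum_(u <- words (steps M) m) weight u * v u * V u <= SB * (2 * expR 1 / 2 ^+ m).
  apply: le_trans (ler_wpM2l SB0 (level_bound m)).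
  rewrite mulr_sumr; apply: ler_sum => u _.
  have [_ _ _ _ [_ H _]] := node u.
  by rewrite -mulrA [leRHS]mulrCA ler_wpM2l.
apply: le_trans (lerD IH H) _; rewrite -mulrDr ler_wpM2l//.
rewrite exprS; have : 0 < 2 ^+ m :> R by rewrite exprn_gt0.
move: (2 ^+ m) (expR 1) => a b a0.
by rewrite le_eqVlt; apply/orP; left; apply/eqP; field; rewrite gt_eqF.
Qed.

Lemma measurable_bounded_ev : measurable (bounded_ev X D M).
Proof.
have -> : bounded_ev X D M = \bigcap_(i in [set: 'I_n]) [set w | `|X i w / D i| < M%:R].
  by apply/seteqP; split => w h i; [move=> _; exact: h|exact: h i I].
apply: fin_bigcap_measurable => // i _; apply: measurable_strict_sublevel.
by apply: measurableT_comp => //; exact: measurable_funM.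
Qed.

Lemma measurable_norm_moment : measurable_fun setT F.
Proof.
have mp a := measurable_powR (R := R) a.
apply: (measurableT_comp (mp p)); apply: (measurableT_comp (mp r^-1)).
apply: measurable_sum => i; apply: (measurableT_comp (mp r)).
exact: measurableT_comp.
Qed.

Lemma bounded_moment :
  (\int[P]_(w in bounded_ev X D M) (F w)%:E <= (SB * (4 * expR 1))%:E)%E.
Proof.
pose G := moment_max D r p M.
have G0 : 0 <= G by exact: powR_ge0.
(* Stopping values before generation [m], plus the nodes of generation [m], on which the moment is
   at most [G]. With [M] fixed, this remainder tends to 0 as [m] grows. *)
have H m : (\int[P]_(w in bounded_ev X D M) (F w)%:E <=
    (SB * (4 * expR 1) + G * (2 * expR 1 / 2 ^+ m))%:E)%E.
  pose I := [seq (true, u) | u <- nodes m] ++ [seq (false, u) | u <- words (steps M) m].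
  pose c (i : bool * seq step) := weight i.2 * (if i.1 then v i.2 else G).
  have c0 i : 0 <= c i by rewrite mulr_ge0//; case: ifP.
  have Fm w : 0 <= F w by exact: powR_ge0.
  have := @integral_le_step d T R P _ I c (fun i => boxev i.2) c0
    (fun=> measurable_boxev _ _ _) _ _ measurable_bounded_ev measurable_norm_moment Fm.
  move=> /(_ _)/le_trans; apply; last first.
    rewrite lee_fin big_cat !big_map/=; apply: lerD; first exact: nodes_bound.
    apply: le_trans (ler_wpM2l G0 (level_bound m)); rewrite mulr_sumr.
    apply: ler_sum => u _; rewrite /c /= mulrAC mulrC ler_wpM2l// ler_wpM2l//.
    rewrite -/(V u); have [V0|Vn0] := eqVneq (V u) 0; first by rewrite V0 powR_ge0.
    by apply: ger1_powR; rewrite ?lt0r ?Vn0 ?box_prob_ge0 ?box_prob_le1//; lra.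
  move=> w Bw; rewrite big_cat !big_map/=.
  apply: le_trans (expand m Bw) _; rewrite lerD2l.
  apply: ler_sum => u _; rewrite /c /= -mulrA; apply: ler_wpM2l; first exact: weight0.
  by apply: ler_wpM2r; [rewrite indicE ler0n|exact: norm_moment_le].
apply/lee_addgt0Pr => e e0.
pose A := G * (2 * expR 1).
have A0 : 0 <= A by rewrite !mulr_ge0// expR_ge0.
pose m := (Num.truncn (A / e)).+1.
apply: le_trans (H m) _; rewrite -EFinD lee_fin lerD2l mulrA -/A.
rewrite ler_pdivrMr ?exprn_gt0// -ler_pdivrMl// mulrC.
apply: le_trans (ltW (truncnS_gt _)) _.
by rewrite -/m -natrX ler_nat ltnW// ltn_expl.
Qed.

End iteration.

(** The tree depends on [M] but its bound does not, so the bounded events can exhaust the space. *)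
Lemma tree_moment d (T : measurableType d) (R : realType) (P : probability T R)
    (n : nat) (X : 'I_n -> {RV P >-> R}) (D : 'I_n -> R) (r p s theta k K : R) :
  log_concave X -> (forall i, 0 < D i) -> 1 <= r -> 1 <= p ->
  (forall i, (\int[P]_w (`|X i w|%:E) <= (D i)%:E)%E) ->
  0 < theta -> theta * entropy_cst R = 2^-1 ->
  (forall M u, exists v q om, node_step X D r p s theta k K M u v q om) ->
  (\int[P]_w (norm_moment X r p w)%:E <= (stop_bound D r p s k K * (4 * expR 1))%:E)%E.
Proof.
move=> hX D0 r1 p1 EX th0 th node.
apply: (@integral_le_exhaustion _ _ _ _ _ (bounded_ev X D)) => //.
- by move=> N; exact: measurable_bounded_ev.
- move=> N N' NN w h i; apply: lt_le_trans (h i) _; by rewrite ler_nat.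
- move=> w; exists (Num.truncn (\sum_i `|X i w / D i|)).+1 => i.
  apply: le_lt_trans (truncnS_gt _).
  by rewrite (bigD1 i)//= lerDl sumr_ge0.
- exact: measurable_norm_moment.
- by move=> w; exact: powR_ge0.
move=> N; rewrite setTI.
have [v Hv] := choice (node N).
have [q Hq] := choice Hv.
have [om Hom] := choice Hq.
exact: (bounded_moment hX D0 r1 p1 EX th0 th Hom).
Qed.

(** * The scales compared with the mean norm *)

Section means.
Context d (T : measurableType d) (R : realType) (P : probability T R) (n : nat).
Context (X : 'I_n -> {RV P >-> R}) (r : R) (r1 : 1 <= r).

Lemma lnorm_pnorm w : lnorm r%:E (random_row X w) = pnorm r (fun i => X i w).
Proof. by rewrite /lnorm /pnorm; under eq_bigr do rewrite mxE. Qed.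

Lemma measurable_pnorm : measurable_fun setT (fun w => pnorm r (fun i => X i w)).
Proof.
have mp a := measurable_powR (R := R) a.
apply: (measurableT_comp (mp r^-1)).
apply: measurable_sum => i; apply: (measurableT_comp (mp r)).
exact: measurableT_comp.
Qed.

(** Jensen's inequality for the norm, up to a factor 2, by duality: pair the means with |D_i|^(r-1)
    and apply [quasi_hoelder] under the integral. *)
Lemma pnorm_mean_le (e delta : R) (m : 'I_n -> R) : 0 < delta ->
  (forall i, \int[P]_w (`|X i w|%:E) = (m i)%:E)%E ->
  (\int[P]_w (pnorm r (fun i => X i w))%:E <= e%:E)%E ->
  pnorm r (fun i => m i + delta) <= 2 * (e + delta * n%:R).
Proof.
move=> d0 mE eE.
have r0 : 0 < r by exact: lt_le_trans r1.
have m0 i : 0 <= m i.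
  by rewrite -lee_fin -mE; apply: integral_ge0 => w _; rewrite lee_fin.
have D0 i : 0 < m i + delta by rewrite ltr_wpDl.
have e0 : 0 <= e.
  rewrite -lee_fin; apply: le_trans eE; apply: integral_ge0 => w _.
  by rewrite lee_fin pnorm_ge0.
pose D i := m i + delta; rewrite -/D.
have [dn0|dnn0] := eqVneq (pnorm r D) 0.
  by rewrite dn0 mulr_ge0// addr_ge0// mulr_ge0// ltW.
have dn : 0 < pnorm r D by rewrite lt0r dnn0 pnorm_ge0.
pose g := pnorm r D `^ (r - 1).
have g0 : 0 < g by exact: powR_gt0.
have c0 i : 0 <= `|D i| `^ (r - 1) by exact: powR_ge0.
have H1 : \sum_i `|D i| `^ (r - 1) * m i <= 2 * g * e.
  rewrite -lee_fin EFinM.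
  have gg : 0 <= 2 * g by rewrite mulr_ge0// ltW.
  apply: le_trans (lee_wpmul2l (_ : (0 <= (2 * g)%:E)%E) eE); last by rewrite lee_fin.
  rewrite -ge0_integralZl_EFin//; first last.
  - by apply/measurable_EFinP; exact: measurable_pnorm.
  - by move=> w _; rewrite lee_fin pnorm_ge0.
  have mt i : measurable_fun setT (fun w => (`|D i| `^ (r - 1))%:E * `|X i w|%:E)%E.
    by apply: measurable_funeM; apply/measurable_EFinP; exact: measurableT_comp.
  have t0 i w : (0 <= (`|D i| `^ (r - 1))%:E * `|X i w|%:E)%E by rewrite mule_ge0// lee_fin.
  apply: le_trans (_ : _ <= \int[P]_w (\sum_i (`|D i| `^ (r - 1))%:E * `|X i w|%:E))%E _.
    rewrite (ge0_integral_sum _ measurableT mt)//.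
    rewrite -sumEFin; apply: lee_sum => i _; rewrite ge0_integralZl_EFin//.
      by rewrite EFinM mE.
    by apply/measurable_EFinP; exact: measurableT_comp.
  apply: ge0_le_integral => //.
  - by move=> w _; exact: sume_ge0.
  - exact: emeasurable_sum.
  - by apply: measurable_funeM; apply/measurable_EFinP; exact: measurable_pnorm.
  move=> w _; under eq_bigr do rewrite -EFinM.
  by rewrite sumEFin -EFinM lee_fin; exact: quasi_hoelder.
have H2 : \sum_i `|D i| `^ (r - 1) * delta <= 2 * g * (delta * n%:R).
  have := quasi_hoelder D (fun=> delta) r1.
  rewrite (gtr0_norm d0) => /le_trans; apply.
  rewrite ler_wpM2l//; first by rewrite mulr_ge0// ltW.
  by apply: le_trans (pnorm_cst_le _ _ r1) _; rewrite (gtr0_norm d0).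
have E : pnorm r D * g = \sum_i `|D i| `^ (r - 1) * m i + \sum_i `|D i| `^ (r - 1) * delta.
  rewrite /g mulr_powRB1 ?pnorm_ge0// powR_pnorm// -big_split; apply: eq_bigr => i _ /=.
  rewrite -mulrDr -(mulr_powRB1 (normr_ge0 _) r0) mulrC; congr (_ * _).
  exact: (gtr0_norm (D0 i)).
rewrite -(ler_pM2r g0) E; apply: le_trans (lerD H1 H2) _.
by rewrite le_eqVlt; apply/orP; left; apply/eqP; ring.
Qed.
End means.

(** * Choice of the constants and limit in the scales *)

Theorem theorem5 (R : realType) :
  exists C2 : R, 1 <= C2 /\
    forall (n : nat), (1 <= n)%N ->
    forall (d : measure_display) (T : measurableType d) (P : probability T R)
      (X : 'I_n -> {RV P >-> R}), log_concave X ->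
    forall r : R, 1 <= r ->
    forall p : R, 1 <= p ->
      ('E_P[(fun w => lnorm r%:E (random_row X w) `^ p)%R] `^ p^-1 <=
       (C2 * r)%:E *
         ('E_P[fun w => lnorm r%:E (random_row X w)] + weak_moment X r p))%E.
Proof.
have ent0 : 0 < entropy_cst R.
  have e0 : 0 < 1 - expR (-1) :> R by rewrite subr_gt0 expR_lt1 oppr_lt0.
  exact: (mulr_gt0 (mulr_gt0 (ltr0n _ 6) (divr_gt0 (ltr0n _ 2) e0)) (expR_gt0 3)).
pose theta : R := (2 * entropy_cst R)^-1.
have theta0 : 0 < theta by rewrite invr_gt0 mulr_gt0.
have thetaE : theta * entropy_cst R = 2^-1.
  by rewrite /theta invfM mulfVK// gt_eqF.
have [k k0 tail] := slab_tail (exprn_gt0 4 theta0).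
have k40 : 0 < k / 4 by rewrite divr_gt0.
have th20 : 0 < theta / (2 * expR (k / 4)) by rewrite divr_gt0// mulr_gt0// expR_gt0.
have [K K1 HK] := powR_expR_le th20 k40.
have [S SE] : exists S, S = stop_cst k K by exists (stop_cst k K).
have S0 : 0 <= S by rewrite SE; exact: stop_cst_ge0.
pose A : R := 4 * expR 1 * S.
have e1 : 1 <= 4 * expR 1 :> R.
  by have := expR_ge1Dx (1 : R); lra.
have A0 : 0 <= A by rewrite mulr_ge0// (le_trans _ e1).
(* The 2 comes from [pnorm_mean_le], and the summand 1 makes the constant at least 1. *)
exists (1 + 2 * A); split; first by lra.
move=> n n0 d T P X hX r r1 p p1.
have r0 : 0 < r by exact: lt_le_trans r1.
have p0 : 0 < p by exact: lt_le_trans p1.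
have C0 : 0 < (1 + 2 * A) * r by rewrite mulr_gt0//; lra.
have weak_ub (t : 'rV[R]_n) : lnorm (hoelder_conjugate r%:E) t <= 1 ->
    ((\int[P]_w (`|\sum_(i < n) t ord0 i * X i w| `^ p)%:E) `^ p^-1 <= weak_moment X r p)%E.
  by move=> t1; apply: ereal_sup_ubound; exists t => //; rewrite unlock.
have weak0 : (0 <= weak_moment X r p)%E.
  have [t [t1 _ _]] := norming_vector (fun=> 0 : R) r1 (n := n).
  by apply: le_trans (weak_ub t t1); exact: poweR_ge0.
rewrite unlock.
have -> : (fun w => ((lnorm r%:E (random_row X w)) `^ p)%:E) = (fun w => (norm_moment X r p w)%:E).
  by apply/funext => w; rewrite lnorm_pnorm.
have -> : (fun w => (lnorm r%:E (random_row X w))%:E) = (fun w => (pnorm r (fun i => X i w))%:E).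
  by apply/funext => w; rewrite lnorm_pnorm.
set E := (\int[P]_w (pnorm r (fun i => X i w))%:E)%E.
have E0 : (0 <= E)%E by apply: integral_ge0 => w _; rewrite lee_fin pnorm_ge0.
have [Ey|Ey] := eqVneq E +oo%E.
  by rewrite Ey addye ?gt0_muley ?leey ?lte_fin// gt_eqF// (lt_le_trans _ weak0).
have [Wy|Wy] := eqVneq (weak_moment X r p) +oo%E.
  by rewrite Wy addey ?gt0_muley ?leey ?lte_fin// gt_eqF// (lt_le_trans _ E0).
have Efin : E \is a fin_num by rewrite ge0_fin_numE// ltey.
have Wfin : weak_moment X r p \is a fin_num by rewrite ge0_fin_numE// ltey.
have [e eE] : exists e, E = e%:E by exists (fine E); rewrite fineK.
have [sg sgE] : exists sg, weak_moment X r p = sg%:E.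
  by exists (fine (weak_moment X r p)); rewrite fineK.
have e0 : 0 <= e by rewrite -lee_fin -eE.
have sg0 : 0 <= sg by rewrite -lee_fin -sgE.
have EXfin i : (\int[P]_w (`|X i w|%:E) <= e%:E)%E.
  rewrite -eE; apply: ge0_le_integral => //.
  - by apply/measurable_EFinP; exact: measurableT_comp.
  - by apply/measurable_EFinP; exact: measurable_pnorm.
  - by move=> w _; rewrite lee_fin (ler_coord_pnorm (fun i => X i w)).
have [m mE] : exists m : 'I_n -> R, forall i, (\int[P]_w (`|X i w|%:E) = (m i)%:E)%E.
  exists (fun i => fine (\int[P]_w (`|X i w|%:E)))%E => i; rewrite fineK//.
  rewrite ge0_fin_numE ?(le_lt_trans (EXfin i)) ?ltry//.
  by apply: integral_ge0 => w _; rewrite lee_fin.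
have m0 i : 0 <= m i.
  by rewrite -lee_fin -mE; apply: integral_ge0 => w _; rewrite lee_fin.
rewrite eE sgE -EFinD -EFinM.
(* A coordinate or the weak moment may vanish, whereas the tree needs positive scales and a positive
   [s]. Both are enlarged by [delta], which tends to 0 in the end while [n] stays fixed. *)
have H (delta : R) : 0 < delta ->
    ((\int[P]_w (norm_moment X r p w)%:E) `^ p^-1 <=
     (A * r * (2 * (e + sg) + (1 + 2 * n%:R) * delta))%:E)%E.
  move=> d0; pose D i := m i + delta; pose s := sg + delta.
  have D0 i : 0 < D i by rewrite ltr_wpDl.
  have s0 : 0 < s by rewrite ltr_wpDl.
  have EX i : (\int[P]_w (`|X i w|%:E) <= (D i)%:E)%E by rewrite mE lee_fin lerDl ltW.
  have weak (t : 'rV[R]_n) : lnorm (hoelder_conjugate r%:E) t <= 1 ->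
      (\int[P]_w (`|\sum_(i < n) t ord0 i * X i w| `^ p)%:E <= (s `^ p)%:E)%E.
    move=> t1; have := weak_ub t t1; rewrite sgE.
    set I := (\int[P]_w _)%E => hI.
    have I0 : (0 <= I)%E by apply: integral_ge0 => w _; rewrite lee_fin powR_ge0.
    have -> : I = ((I `^ p^-1) `^ p)%E by rewrite -poweRrM mulVf ?gt_eqF// poweRe1.
    rewrite -poweR_EFin; apply: gt0_ler_poweR; rewrite ?(ltW p0)//.
    - by rewrite in_itv/= poweR_ge0 leey.
    - by rewrite in_itv/= lee_fin (ltW s0) leey.
    by apply: le_trans hI _; rewrite lee_fin lerDl ltW.
  have TM := tree_moment hX D0 r1 p1 EX theta0 thetaE
    (fun M u => node_step_exists hX D0 n0 r1 p1 s0 weak theta0 k0 K1 tail HK M u).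
  have DN : pnorm r D <= 2 * (e + delta * n%:R).
    by apply: (pnorm_mean_le r1 d0 mE); rewrite -/E eE.
  have pD0 := pnorm_ge0 r D.
  set I := (\int[P]_w _)%E in TM *.
  have I0 : (0 <= I)%E by apply: integral_ge0 => w _; rewrite lee_fin powR_ge0.
  rewrite /stop_bound -SE in TM.
  have pV : 0 <= p^-1 by rewrite invr_ge0 ltW.
  have b0 : 0 <= S * r * (s + pnorm r D) by rewrite !mulr_ge0 ?(ltW r0)// addr_ge0// ltW.
  have e10 : 0 <= 4 * expR 1 :> R by exact: le_trans e1.
  apply: (@le_trans _ _ (((S * r * (s + pnorm r D)) `^ p * (4 * expR 1))%:E `^ p^-1)%E).
    apply: gt0_ler_poweR => //.
    - by rewrite in_itv/= I0 leey.
    - by rewrite in_itv/= lee_fin leey andbT mulr_ge0// powR_ge0.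
  rewrite poweR_EFin lee_fin powRM ?powR_ge0// -powRrM divff ?gt_eqF// powRr1//.
  apply: (@le_trans _ _ (S * r * (s + pnorm r D) * (4 * expR 1))).
    by rewrite ler_wpM2l//; apply: ler1_powR => //; rewrite invf_le1.
  have -> : S * r * (s + pnorm r D) * (4 * expR 1) = A * r * (s + pnorm r D).
    by rewrite /A; ring.
  rewrite ler_wpM2l ?mulr_ge0 ?(ltW r0)//.
  rewrite /s; move: (pnorm r D) DN => z; lra.
apply/lee_addgt0Pr => eps eps0.
pose B : R := A * r * (1 + 2 * n%:R).
have B0 : 0 <= B by rewrite !mulr_ge0 ?(ltW r0)// addr_ge0// mulr_ge0.
have d0 : 0 < eps / (B + 1) by rewrite divr_gt0// ltr_wpDl.
apply: le_trans (H _ d0) _; rewrite -EFinD lee_fin.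
have : B * (eps / (B + 1)) <= eps.
  rewrite mulrCA ger_pMr// ler_pdivrMr ?ltr_wpDl// mul1r; lra.
have : 0 <= r * (e + sg) by rewrite mulr_ge0 ?(ltW r0)// addr_ge0.
move: (eps / (B + 1)) => z h1 h2.
have -> : A * r * (2 * (e + sg) + (1 + 2 * n%:R) * z) = 2 * A * (r * (e + sg)) + B * z.
  by rewrite /B; ring.
have -> : (1 + 2 * A) * r * (e + sg) = r * (e + sg) + 2 * A * (r * (e + sg)) by ring.
lra.
Qed.
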